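(* (In $\mathbf{ZF}$.) Let $\mathbf{X}$ be a second-countable, metrizable Loeb space. Then the following conditions are all equivalent: (i) $\mathbf{X}$ is sequential; (ii) every sequentially closed subspace of $\mathbf{X}$ is separable; (iii) the family of all non-empty sequentially closed subsets of $\mathbf{X}$ has a choice function; (iv) every sequentially closed subset of $\mathbf{X}$ is of type $F_\sigma$ in $\mathbf{X}$; (v) every sequentially closed subset $A$ of $\mathbf{X}$ contains an $F_\sigma$-set $D$ of $\mathbf{X}$ such that $D$ is dense in the subspace $A$ of $\mathbf{X}$; (vi) every sequentially closed subset $A$ of $\mathbf{X}$ contains a set $D$ such that $D$ is expressible as a well-ordered union of well-orderable sets and $D$ is dense in the subspace $A$ of $\mathbf{X}$; (vii) every $F_\sigma$-subspace $\mathbf{P}$ of $\mathbf{X}$ is sequential. In particular, for every second-countable, Cantor completely metrizable space $\mathbf{X}$, conditions (i)–(vii) are all equivalent.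
   Context: The result is a theorem of $\mathbf{ZF}$ (Zermelo–Fraenkel set theory without the axiom of choice). A topological space is Loeb if the family of all its non-empty closed subsets has a choice function. A set $A\subseteq X$ is sequentially closed in $\mathbf{X}$ if every point of $X$ which is a limit of a sequence of points of $A$ converging in $\mathbf{X}$ belongs to $A$. A space is sequential if its sequentially closed sets are exactly its closed sets. A set is of type $F_\sigma$ (is an $F_\sigma$-set) if it is a countable union of closed sets. A well-ordered union of well-orderable sets is a set of the form $\bigcup_{\alpha\in\kappa}D_\alpha$ with $\kappa$ an ordinal and each $D_\alpha$ well-orderable. For a metric $d$ on $X$, $\tau(d)$ is the topology induced by $d$ and $\delta_d(A)=\sup\{d(x,y):x,y\in A\}$. A metric $d$ on $X$ is Cantor complete if, for every descending family $\{F_n:n\in\omega\}$ of non-empty closed subsets of $\langle X,\tau(d)\rangle$ with $\lim_{n\to+\infty}\delta_d(F_n)=0$, we have $\bigcap_{n\in\omega}F_n\neq\emptyset$. A topological space $\langle X,\tau\rangle$ is Cantor completely metrizable if there is a Cantor complete metric $d$ on $X$ with $\tau=\tau(d)$. *)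

(* Defs.v *)
(* Plain Rocq and Stdlib lists.  "In ZF" is rendered as "in every model of
   first-order ZF": Separation and Replacement are schemas over formulas, so a
   choice principle of the ambient logic does not give choice functions inside
   the model.  Every notion from [subset] on is a relation on the universe [V]
   whose quantifiers range over [V] only, that is, a first-order formula of the
   language of set theory; all functions, relations, sequences and real numbers
   are elements of [V]. *)
From Stdlib Require Import List.
Import ListNotations.

(* Formulas over membership and equality, with de Bruijn variables. *)
Inductive formula : Set :=
| f_mem (i j : nat)
| f_eq (i j : nat)
| f_false
| f_imp (p q : formula)
| f_and (p q : formula)
| f_or (p q : formula)
| f_all (p : formula)
| f_ex (p : formula).

Definition scons {V : Type} (x : V) (e : nat -> V) (n : nat) : V :=
  match n with
  | 0 => x
  | S m => e m
  end.

(* All the components are sets of the model: [r_add] and [r_mul] are functions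
   on the product of the carrier with itself, [r_le] is a set of ordered pairs. *)
Record field_data (V : Type) : Type := FieldData {
  r_carrier : V;
  r_add : V;
  r_mul : V;
  r_zero : V;
  r_one : V;
  r_le : V
}.
Arguments FieldData {V}.
Arguments r_carrier {V}.
Arguments r_add {V}.
Arguments r_mul {V}.
Arguments r_zero {V}.
Arguments r_one {V}.
Arguments r_le {V}.

Definition all_equivalent (l : list Prop) : Prop :=
  forall P Q : Prop, In P l -> In Q l -> (P <-> Q).

Section SetTheory.

Context {V : Type} (E : V -> V -> Prop).

Local Notation "x ∈ y" := (E x y) (at level 70).

Fixpoint sat (e : nat -> V) (p : formula) : Prop :=
  match p with
  | f_mem i j => e i ∈ e j
  | f_eq i j => e i = e j
  | f_false => False
  | f_imp p q => sat e p -> sat e q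
  | f_and p q => sat e p /\ sat e q
  | f_or p q => sat e p \/ sat e q
  | f_all p => forall x, sat (scons x e) p
  | f_ex p => exists x, sat (scons x e) p
  end.

Definition subset (a b : V) : Prop := forall x, x ∈ a -> x ∈ b.

(* [s] is the set of all the [x] such that [P x]. *)
Definition is_set_of (s : V) (P : V -> Prop) : Prop := forall x, x ∈ s <-> P x.

Definition nonempty (a : V) : Prop := exists x, x ∈ a.
Definition is_empty (a : V) : Prop := forall x, ~ x ∈ a.
Definition is_upair (p a b : V) : Prop := is_set_of p (fun x => x = a \/ x = b).
Definition is_union (u s : V) : Prop :=
  is_set_of u (fun x => exists y, y ∈ s /\ x ∈ y).
Definition is_powerset (p a : V) : Prop := is_set_of p (fun x => subset x a).
Definition is_inter (c a b : V) : Prop := is_set_of c (fun x => x ∈ a /\ x ∈ b).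
Definition is_diff (c a b : V) : Prop := is_set_of c (fun x => x ∈ a /\ ~ x ∈ b).
Definition is_succ (s n : V) : Prop := is_set_of s (fun x => x ∈ n \/ x = n).

Definition inductive_set (w : V) : Prop :=
  (exists z, is_empty z /\ z ∈ w) /\
  (forall n, n ∈ w -> exists s, is_succ s n /\ s ∈ w).

Record ZF : Prop := {
  zf_extensionality : forall a b, (forall x, x ∈ a <-> x ∈ b) -> a = b;
  zf_foundation : forall a, nonempty a ->
    exists x, x ∈ a /\ forall y, y ∈ a -> ~ y ∈ x;
  zf_pairing : forall a b, exists p, is_upair p a b;
  zf_union : forall s, exists u, is_union u s;
  zf_powerset : forall a, exists p, is_powerset p a;
  zf_infinity : exists w, inductive_set w;
  zf_separation : forall (p : formula) (e : nat -> V) (a : V),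
    exists b, is_set_of b (fun x => x ∈ a /\ sat (scons x e) p);
  (* variable 0 is the argument, variable 1 is the value *)
  zf_replacement : forall (p : formula) (e : nat -> V) (a : V),
    (forall x y z, x ∈ a -> sat (scons x (scons y e)) p ->
       sat (scons x (scons z e)) p -> y = z) ->
    exists b, is_set_of b
      (fun y => exists x, x ∈ a /\ sat (scons x (scons y e)) p)
}.

(* Kuratowski pairs *)
Definition is_opair (p a b : V) : Prop :=
  is_set_of p (fun z => is_upair z a a \/ is_upair z a b).

Definition is_product (p a b : V) : Prop :=
  is_set_of p (fun z => exists x y, x ∈ a /\ y ∈ b /\ is_opair z x y).

(* The pair of [x] and [y] belongs to [f]; for a function [f], its value at
   [x] is [y]. *)
Definition value (f x y : V) : Prop := exists p, is_opair p x y /\ p ∈ f.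

Definition function_on (f a : V) : Prop :=
  (forall p, p ∈ f -> exists x y, x ∈ a /\ is_opair p x y) /\
  (forall x, x ∈ a -> exists! y, value f x y).

Definition maps_to (f a b : V) : Prop :=
  function_on f a /\ forall x y, value f x y -> y ∈ b.

Definition injection (f a b : V) : Prop :=
  maps_to f a b /\
  forall x x' y, value f x y -> value f x' y -> x = x'.

Definition is_omega (w : V) : Prop :=
  inductive_set w /\ forall u, inductive_set u -> subset w u.

Definition natural (n : V) : Prop := exists w, is_omega w /\ n ∈ w.
Definition nat_le (m n : V) : Prop := m ∈ n \/ m = n.

(* Finite sets are countable. *)
Definition countable (a : V) : Prop :=
  exists w f, is_omega w /\ injection f a w.

Definition strict_well_order (a : V) (lt : V -> V -> Prop) : Prop :=
  (forall x, x ∈ a -> ~ lt x x) /\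
  (forall x y z, x ∈ a -> y ∈ a -> z ∈ a -> lt x y -> lt y z -> lt x z) /\
  (forall x y, x ∈ a -> y ∈ a -> lt x y \/ x = y \/ lt y x) /\
  (forall b, subset b a -> nonempty b ->
     exists m, m ∈ b /\ forall x, x ∈ b -> m = x \/ lt m x).

Definition ordinal (k : V) : Prop :=
  (forall x, x ∈ k -> subset x k) /\ strict_well_order k E.

Definition well_orderable (a : V) : Prop :=
  exists r, strict_well_order a (value r).

(* [g] is the family of the [D_alpha] for [alpha] in the ordinal [k]. *)
Definition wo_union_of_wo_sets (D : V) : Prop :=
  exists k g, ordinal k /\ function_on g k /\
    (forall alpha S, value g alpha S -> well_orderable S) /\
    is_set_of D (fun x => exists alpha S, value g alpha S /\ x ∈ S).

Definition has_choice_function (F : V) : Prop :=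
  exists f, function_on f F /\ forall A y, value f A y -> y ∈ A.

Definition binop (o : V) (x y z : V) : Prop :=
  exists p, is_opair p x y /\ value o p z.

Definition binop_on (o R : V) : Prop :=
  exists P, is_product P R R /\ maps_to o P R.

(* Equational laws in relational form: [binop o x y s] says that the result of
   [o] at [x], [y] is [s]; existence of the results is part of [binop_on]. *)
Definition op_assoc (o : V) : Prop := forall x y z s t u,
  binop o x y s -> binop o y z t -> binop o s z u -> binop o x t u.
Definition op_comm (o : V) : Prop := forall x y s,
  binop o x y s -> binop o y x s.

Definition rle (K : field_data V) (x y : V) : Prop := value (r_le K) x y.
Definition rlt (K : field_data V) (x y : V) : Prop := rle K x y /\ x <> y.

Definition is_sup (K : field_data V) (P : V -> Prop) (s : V) : Prop :=
  s ∈ r_carrier K /\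
  (forall x, P x -> rle K x s) /\
  (forall u, u ∈ r_carrier K -> (forall x, P x -> rle K x u) -> rle K s u).

(* The real numbers, as a Dedekind complete ordered field: in ZF there is one,
   and it is unique up to isomorphism. *)
Record is_reals (K : field_data V) : Prop := {
  reals_add_op : binop_on (r_add K) (r_carrier K);
  reals_mul_op : binop_on (r_mul K) (r_carrier K);
  reals_zero_in : r_zero K ∈ r_carrier K;
  reals_one_in : r_one K ∈ r_carrier K;
  reals_add_assoc : op_assoc (r_add K);
  reals_add_comm : op_comm (r_add K);
  reals_add_zero : forall x, x ∈ r_carrier K -> binop (r_add K) x (r_zero K) x;
  reals_add_opp : forall x, x ∈ r_carrier K ->
    exists y, y ∈ r_carrier K /\ binop (r_add K) x y (r_zero K);
  reals_mul_assoc : op_assoc (r_mul K);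
  reals_mul_comm : op_comm (r_mul K);
  reals_mul_one : forall x, x ∈ r_carrier K -> binop (r_mul K) x (r_one K) x;
  reals_mul_inv : forall x, x ∈ r_carrier K -> x <> r_zero K ->
    exists y, y ∈ r_carrier K /\ binop (r_mul K) x y (r_one K);
  reals_one_neq_zero : r_one K <> r_zero K;
  reals_distr : forall x y z s p q u,
    binop (r_add K) y z s -> binop (r_mul K) x y p -> binop (r_mul K) x z q ->
    binop (r_mul K) x s u -> binop (r_add K) p q u;
  reals_le_refl : forall x, x ∈ r_carrier K -> rle K x x;
  reals_le_antisym : forall x y, x ∈ r_carrier K -> y ∈ r_carrier K ->
    rle K x y -> rle K y x -> x = y;
  reals_le_trans : forall x y z,
    x ∈ r_carrier K -> y ∈ r_carrier K -> z ∈ r_carrier K ->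
    rle K x y -> rle K y z -> rle K x z;
  reals_le_total : forall x y, x ∈ r_carrier K -> y ∈ r_carrier K ->
    rle K x y \/ rle K y x;
  reals_le_add : forall x y z s t, x ∈ r_carrier K -> y ∈ r_carrier K ->
    rle K x y -> binop (r_add K) x z s -> binop (r_add K) y z t -> rle K s t;
  reals_le_mul : forall x y p,
    rle K (r_zero K) x -> rle K (r_zero K) y -> binop (r_mul K) x y p ->
    rle K (r_zero K) p;
  reals_complete : forall S, subset S (r_carrier K) -> nonempty S ->
    (exists u, u ∈ r_carrier K /\ forall x, x ∈ S -> rle K x u) ->
    exists s, is_sup K (fun x => x ∈ S) s
}.

Definition is_topology (X T : V) : Prop :=
  (forall U, U ∈ T -> subset U X) /\
  (forall U, is_empty U -> U ∈ T) /\
  X ∈ T /\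
  (forall S U, subset S T -> is_union U S -> U ∈ T) /\
  (forall U W I, U ∈ T -> W ∈ T -> is_inter I U W -> I ∈ T).

Definition closed_set (X T C : V) : Prop :=
  subset C X /\ exists U, U ∈ T /\ is_diff U X C.

Definition subspace_topology (T A TA : V) : Prop :=
  is_set_of TA (fun W => exists U, U ∈ T /\ is_inter W U A).

Definition dense (X T D : V) : Prop :=
  subset D X /\
  forall U, U ∈ T -> nonempty U -> exists x, x ∈ U /\ x ∈ D.

Definition dense_in_subspace (T A D : V) : Prop :=
  exists TA, subspace_topology T A TA /\ dense A TA D.

Definition separable (X T : V) : Prop := exists D, countable D /\ dense X T D.

Definition is_base (T B : V) : Prop :=
  subset B T /\
  forall U x, U ∈ T -> x ∈ U -> exists W, W ∈ B /\ x ∈ W /\ subset W U.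

Definition second_countable (T : V) : Prop := exists B, is_base T B /\ countable B.

Definition F_sigma (X T A : V) : Prop :=
  exists C, countable C /\ (forall F, F ∈ C -> closed_set X T F) /\ is_union A C.

Definition sequence_in (s A : V) : Prop := exists w, is_omega w /\ maps_to s w A.

Definition converges (T s x : V) : Prop :=
  forall U, U ∈ T -> x ∈ U ->
  exists m, natural m /\
    forall n y, natural n -> nat_le m n -> value s n y -> y ∈ U.

Definition seq_closed (X T A : V) : Prop :=
  subset A X /\
  forall s x, sequence_in s A -> x ∈ X -> converges T s x -> x ∈ A.

Definition sequential (X T : V) : Prop :=
  forall A, seq_closed X T A <-> closed_set X T A.

Definition Loeb (X T : V) : Prop :=
  exists F, is_set_of F (fun A => closed_set X T A /\ nonempty A) /\
    has_choice_function F.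

Definition dist (d x y r : V) : Prop := binop d x y r.

Definition is_metric (K : field_data V) (X d : V) : Prop :=
  (exists P, is_product P X X /\ maps_to d P (r_carrier K)) /\
  (forall x y r, dist d x y r -> rle K (r_zero K) r) /\
  (forall x y, x ∈ X -> y ∈ X -> (dist d x y (r_zero K) <-> x = y)) /\
  (forall x y r, dist d x y r -> dist d y x r) /\
  (forall x y z r s t u, dist d x y r -> dist d y z s -> dist d x z t ->
     binop (r_add K) r s u -> rle K t u).

Definition metric_topology (K : field_data V) (X d T : V) : Prop :=
  is_set_of T (fun U => subset U X /\
    forall x, x ∈ U -> exists eps, eps ∈ r_carrier K /\ rlt K (r_zero K) eps /\
      forall y r, dist d x y r -> rlt K r eps -> y ∈ U).

Definition metrizable (X T : V) : Prop :=
  exists (K : field_data V) (d : V),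
    is_reals K /\ is_metric K X d /\ metric_topology K X d T.

Definition diameter (K : field_data V) (d A s : V) : Prop :=
  is_sup K (fun r => exists x y, x ∈ A /\ y ∈ A /\ dist d x y r) s.

(* [F] is a sequence of sets.  The diameter of an unbounded set is infinite, so
   that a set has diameter less than [eps] when it has a real diameter and this
   diameter is less than [eps]. *)
Definition diameters_tend_to_zero (K : field_data V) (d F : V) : Prop :=
  forall eps, eps ∈ r_carrier K -> rlt K (r_zero K) eps ->
  exists m, natural m /\
    forall n A, natural n -> nat_le m n -> value F n A ->
    exists s, diameter K d A s /\ rlt K s eps.

Definition cantor_complete (K : field_data V) (X d : V) : Prop :=
  forall T, metric_topology K X d T ->
  forall w F, is_omega w -> function_on F w ->
    (forall n A, value F n A -> closed_set X T A /\ nonempty A) ->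
    (forall m n A B, nat_le m n -> value F m A -> value F n B -> subset B A) ->
    diameters_tend_to_zero K d F ->
    exists x, forall n A, value F n A -> x ∈ A.

Definition cantor_completely_metrizable (X T : V) : Prop :=
  exists (K : field_data V) (d : V),
    is_reals K /\ is_metric K X d /\ metric_topology K X d T /\
    cantor_complete K X d.

Definition seq_closed_subspaces_separable (X T : V) : Prop :=
  forall A TA, seq_closed X T A -> subspace_topology T A TA -> separable A TA.

Definition seq_closed_sets_have_choice (X T : V) : Prop :=
  exists F, is_set_of F (fun A => seq_closed X T A /\ nonempty A) /\
    has_choice_function F.

Definition seq_closed_sets_F_sigma (X T : V) : Prop :=
  forall A, seq_closed X T A -> F_sigma X T A.

Definition seq_closed_sets_F_sigma_dense (X T : V) : Prop :=
  forall A, seq_closed X T A ->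
  exists D, subset D A /\ F_sigma X T D /\ dense_in_subspace T A D.

Definition seq_closed_sets_wo_dense (X T : V) : Prop :=
  forall A, seq_closed X T A ->
  exists D, subset D A /\ wo_union_of_wo_sets D /\ dense_in_subspace T A D.

Definition F_sigma_subspaces_sequential (X T : V) : Prop :=
  forall P TP, F_sigma X T P -> subspace_topology T P TP -> sequential P TP.

Definition sequentiality_conditions (X T : V) : list Prop :=
  [ sequential X T;
    seq_closed_subspaces_separable X T;
    seq_closed_sets_have_choice X T;
    seq_closed_sets_F_sigma X T;
    seq_closed_sets_F_sigma_dense X T;
    seq_closed_sets_wo_dense X T;
    F_sigma_subspaces_sequential X T ].

End SetTheory.

(* Main.v *)
From Stdlib Require Import Classical ClassicalEpsilon.
Require Import Defs.

(** All the conditions are compared with sequentiality.  A closed set is always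
    sequentially closed, so that sequentiality means that every sequentially
    closed set [A] contains the points [x] adherent to it.  For this one has to
    produce a sequence of points of [A] that converges to [x], without choice.

    Second countability and regularity, which is all that is kept of the metric,
    give for every [x] a sequence [nbhd n x] of closed neighbourhoods that
    shrinks to [x] and is definable from [x] and an injection of a base into [omega].  Any
    definable way of choosing a point of [A] in every [nbhd n x] then gives the
    sequence ([selected_sequence]).  Such choices come from a choice function for
    the sequentially closed sets, applied to the traces of [A] on the
    neighbourhoods; or from a well-ordering of a subset of [A] to which [x] is
    adherent; or from a well-ordered family of closed subsets of [A] with [x]
    adherent to its union: take the first member that meets [nbhd n x] and
    apply the Loeb choice function to its intersection with [nbhd n x]
    ([well_ordered_closed_sequence]).  The last case settles the conditions on
    F-sigma sets, and it settles the condition on well-ordered unions because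
    the closure of a well-orderable subset of [A] is contained in [A]
    ([well_orderable_closure]).  In the other direction, when [A] is closed a
    countable dense subset is obtained by choosing a point in the intersection
    of [A] with the closure of every basic open set that meets [A].

    A second-countable space with a Cantor complete metric is Loeb: given a
    closed non-empty [A], intersect repeatedly with the closure of the first
    basic open set that meets the current set and cuts its diameter by half.
    The diameters tend to zero, and the unique common point is the chosen one
    ([Cantor_complete_Loeb]).

    All of this takes place in a model of ZF, where Separation is available for
    formulas only.  A calculus of definable predicates and operations on the
    universe shows that each set needed is given by a formula with parameters. *)

(** * Definable predicates and operations *)

Section InModel.

Context {V : Type} (E : V -> V -> Prop) (HZF : ZF E).
Local Notation env := (nat -> V).
Local Notation "x ∈ y" := (E x y) (at level 70).

(** Renaming of the variables of a formula. *)
Fixpoint ren (xi : nat -> nat) (p : formula) : formula :=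
  match p with
  | f_mem i j => f_mem (xi i) (xi j)
  | f_eq i j => f_eq (xi i) (xi j)
  | f_false => f_false
  | f_imp p q => f_imp (ren xi p) (ren xi q)
  | f_and p q => f_and (ren xi p) (ren xi q)
  | f_or p q => f_or (ren xi p) (ren xi q)
  | f_all p => f_all (ren (fun n => match n with 0 => 0 | S m => S (xi m) end) p)
  | f_ex p => f_ex (ren (fun n => match n with 0 => 0 | S m => S (xi m) end) p)
  end.

Lemma sat_ren (p : formula) : forall (xi : nat -> nat) (e e' : env),
  (forall n, e' n = e (xi n)) -> (sat E e (ren xi p) <-> sat E e' p).
Proof.
  induction p; intros xi e e' H; simpl.
  - rewrite !H; tauto.
  - rewrite !H; tauto.
  - tauto.
  - rewrite IHp1, IHp2 by eassumption; tauto.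
  - rewrite IHp1, IHp2 by eassumption; tauto.
  - rewrite IHp1, IHp2 by eassumption; tauto.
  - split; intros A x; refine (proj1 (IHp _ _ _ _) (A x)) ||
      refine (proj2 (IHp _ _ (scons x e') _) (A x)); intros [|n]; simpl; auto.
  - split; intros [x A]; exists x; revert A;
      (refine (proj1 (IHp _ _ _ _)) || refine (proj2 (IHp _ _ (scons x e') _)));
      intros [|n]; simpl; auto.
Qed.

(** Variable [n] of a formula denotes either a variable of the environment or a
    parameter from the universe, as told by [f n]. *)
Definition lookup (f : nat -> nat + V) (e : env) : env :=
  fun n => match f n with inl i => e i | inr c => c end.

(** Definability by a first-order formula with parameters. *)
Definition definable (P : env -> Prop) : Prop :=
  exists p f, forall e, P e <-> sat E (lookup f e) p.

(** A term is definable when its graph is, variable 0 being the value and the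
    environment being shifted by one. *)
Definition definable_term (t : env -> V) : Prop :=
  definable (fun e => e 0 = t (fun n => e (S n))).

(** Definable classes, relations and operations on the universe. *)
Definition definable1 (P : V -> Prop) : Prop := definable (fun e => P (e 0)).
Definition definable2 (P : V -> V -> Prop) : Prop :=
  definable (fun e => P (e 0) (e 1)).
Definition definable_fun (F : V -> V) : Prop :=
  definable (fun e => e 0 = F (e 1)).

(** [weave f g] has the values of [f] at the even numbers and those of [g] at the
    odd ones; it merges the parameters of two formulas. *)
Fixpoint weave {A} (f g : nat -> A) (n : nat) : A :=
  match n with 0 => f 0 | S m => weave g (fun k => f (S k)) m end.
Fixpoint dbl (n : nat) : nat := match n with 0 => 0 | S m => S (S (dbl m)) end.

Lemma weave_dbl {A} (n : nat) : forall f g : nat -> A, weave f g (dbl n) = f n.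
Proof. induction n; intros f g; simpl; [reflexivity|]. now rewrite IHn. Qed.

Lemma definable_iff (P Q : env -> Prop) :
  definable Q -> (forall e, P e <-> Q e) -> definable P.
Proof. intros (p & f & H) HPQ. exists p, f. intros e. now rewrite HPQ. Qed.

Lemma definable_ren (xi : nat -> nat) (P : env -> Prop) :
  definable P -> definable (fun e => P (fun n => e (xi n))).
Proof.
  intros (p & f & H).
  exists (ren (fun n => n) p),
    (fun n => match f n with inl i => inl (xi i) | inr c => inr c end).
  intros e. rewrite H. symmetry. apply sat_ren.
  intros n. unfold lookup. now destruct (f n).
Qed.

Lemma definable_op (c : Prop -> Prop -> Prop) (C : formula -> formula -> formula)
  (P Q : env -> Prop) :
  (forall e p q, sat E e (C p q) <-> c (sat E e p) (sat E e q)) ->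
  (forall A A' B B', (A <-> A') -> (B <-> B') -> (c A B <-> c A' B')) ->
  definable P -> definable Q -> definable (fun e => c (P e) (Q e)).
Proof.
  intros HC Hc (p & f & Hp) (q & g & Hq).
  exists (C (ren dbl p) (ren (fun n => S (dbl n)) q)), (weave f g).
  intros e. rewrite HC. apply Hc; [rewrite Hp | rewrite Hq]; symmetry;
    apply sat_ren; intros n; unfold lookup.
  - now rewrite weave_dbl.
  - simpl. now rewrite weave_dbl.
Qed.

Lemma definable_and P Q :
  definable P -> definable Q -> definable (fun e => P e /\ Q e).
Proof. apply (definable_op and f_and); simpl; intros; tauto. Qed.

Lemma definable_or P Q :
  definable P -> definable Q -> definable (fun e => P e \/ Q e).
Proof. apply (definable_op or f_or); simpl; intros; tauto. Qed.

Lemma definable_imp P Q :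
  definable P -> definable Q -> definable (fun e => P e -> Q e).
Proof. apply (definable_op (fun A B => A -> B) f_imp); simpl; intros; tauto. Qed.

(** A statement without free variables is equivalent to truth or to falsity. *)
Lemma definable_const (A : Prop) : definable (fun _ => A).
Proof.
  destruct (classic A) as [H|H].
  - exists (f_imp f_false f_false), (fun n => inl n). simpl; intros; tauto.
  - exists f_false, (fun n => inl n). simpl; intros; tauto.
Qed.

Lemma definable_not P : definable P -> definable (fun e => ~ P e).
Proof. intros H. apply definable_imp; [exact H | apply definable_const]. Qed.

Lemma definable_equiv P Q :
  definable P -> definable Q -> definable (fun e => P e <-> Q e).
Proof. intros HP HQ. apply definable_and; apply definable_imp; assumption. Qed.

(** Separates the variable about to be bound, which must stay variable 0, from
    the other variables and the parameters. *)
Lemma sat_bind (p : formula) (f : nat -> nat + V) :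
  exists p' f', forall x e,
    sat E (scons x (lookup f' e)) p' <-> sat E (lookup f (scons x e)) p.
Proof.
  exists (ren (fun n => match f n with inl 0 => 0 | _ => S n end) p),
    (fun n => match f n with inl (S i) => inl i | inl 0 => inl 0 | inr c => inr c end).
  intros x e. apply sat_ren. intros n. unfold lookup.
  destruct (f n) as [[|i]|c] eqn:Hn; simpl; rewrite ?Hn; reflexivity.
Qed.

Lemma definable_ex (P : env -> V -> Prop) :
  definable (fun e => P (fun n => e (S n)) (e 0)) ->
  definable (fun e => exists x, P e x).
Proof.
  intros (p & f & H). destruct (sat_bind p f) as (p' & f' & H').
  exists (f_ex p'), f'. intros e. simpl.
  split; intros [x Hx]; exists x.
  - apply H'. now apply (proj1 (H (scons x e))).
  - apply (proj2 (H (scons x e))). now apply H'.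
Qed.

Lemma definable_all (P : env -> V -> Prop) :
  definable (fun e => P (fun n => e (S n)) (e 0)) ->
  definable (fun e => forall x, P e x).
Proof.
  intros (p & f & H). destruct (sat_bind p f) as (p' & f' & H').
  exists (f_all p'), f'. intros e. simpl.
  split; intros Hx x.
  - apply H'. exact (proj1 (H (scons x e)) (Hx x)).
  - apply (proj2 (H (scons x e))). apply H', Hx.
Qed.

Lemma definable_term_var (i : nat) : definable_term (fun e => e i).
Proof. exists (f_eq 0 (S i)), (fun n => inl n). intros e. simpl. tauto. Qed.

Lemma definable_term_const (c : V) : definable_term (fun _ => c).
Proof.
  exists (f_eq 0 1), (fun n => match n with 0 => inl 0 | _ => inr c end).
  intros e. simpl. tauto.
Qed.

Lemma definable_subst (P : env -> V -> Prop) (t : env -> V) :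
  definable (fun e => P (fun n => e (S n)) (e 0)) -> definable_term t ->
  definable (fun e => P e (t e)).
Proof.
  intros HP Ht.
  apply (definable_iff _ (fun e => exists x, x = t e /\ P e x)).
  - apply definable_ex, definable_and; assumption.
  - intros e. split; [eauto | now intros (x & -> & Hx)].
Qed.

Lemma definable_term_tail (t : env -> V) :
  definable_term t -> definable_term (fun e => t (fun n => e (S n))).
Proof.
  intros H.
  exact (definable_ren (fun n => match n with 0 => 0 | S m => S (S m) end) _ H).
Qed.

Lemma definable_rel1 (R : V -> Prop) (t : env -> V) :
  definable1 R -> definable_term t -> definable (fun e => R (t e)).
Proof.
  intros HR Ht. apply (definable_subst (fun _ x => R x)); assumption.
Qed.

Lemma definable_rel2 (R : V -> V -> Prop) (t u : env -> V) :
  definable2 R -> definable_term t -> definable_term u ->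
  definable (fun e => R (t e) (u e)).
Proof.
  intros HR Ht Hu. apply (definable_subst (fun e x => R x (u e))); [|exact Ht].
  apply (definable_subst (fun e y => R (e 0) y));
    [|now apply definable_term_tail].
  exact (definable_ren (fun n => match n with 0 => 1 | S m => 0 end) _ HR).
Qed.

Lemma definable_rel3 (R : V -> V -> V -> Prop) (t u v : env -> V) :
  definable (fun e => R (e 0) (e 1) (e 2)) ->
  definable_term t -> definable_term u -> definable_term v ->
  definable (fun e => R (t e) (u e) (v e)).
Proof.
  intros HR Ht Hu Hv.
  apply (definable_subst (fun e x => R x (u e) (v e))); [|exact Ht].
  apply (definable_subst (fun e y => R (e 0) y (v (fun n => e (S n)))));
    [|now apply definable_term_tail].
  apply (definable_subst (fun e z => R (e 1) (e 0) z));
    [|now apply (definable_term_tail (fun e => v (fun n => e (S n)))),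
         definable_term_tail].
  exact (definable_ren
    (fun n => match n with 0 => 2 | 1 => 1 | _ => 0 end) _ HR).
Qed.

Lemma definable_mem (t u : env -> V) :
  definable_term t -> definable_term u -> definable (fun e => E (t e) (u e)).
Proof.
  apply definable_rel2. exists (f_mem 0 1), (fun n => inl n). simpl; intros; tauto.
Qed.

Lemma definable_eq (t u : env -> V) :
  definable_term t -> definable_term u -> definable (fun e => t e = u e).
Proof.
  apply definable_rel2. exists (f_eq 0 1), (fun n => inl n). simpl; intros; tauto.
Qed.

Lemma definable_term_fun (F : V -> V) (t : env -> V) :
  definable_fun F -> definable_term t -> definable_term (fun e => F (t e)).
Proof.
  intros HF Ht. apply (definable_rel2 (fun a b => a = F b) (fun e => e 0)).
  - exact HF.
  - apply definable_term_var.
  - now apply definable_term_tail.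
Qed.

Lemma universe_inhabited : inhabited V.
Proof. destruct (zf_infinity E HZF) as [w _]. constructor. exact w. Qed.


(** An arbitrary element of the universe. *)
Definition dflt : V := epsilon universe_inhabited (fun _ => True).
(** The unique [x] such that [P x], and [dflt] when there is no such [x] or more
    than one.  The ambient choice operator only names uniquely determined
    elements, so that [the] preserves definability ([definable_the]). *)
Definition the (P : V -> Prop) : V :=
  epsilon universe_inhabited (fun x => (P x /\ forall y, P y -> y = x) \/
    (~ (exists z, P z /\ forall y, P y -> y = z) /\ x = dflt)).

Lemma the_cases P :
  (P (the P) /\ forall y, P y -> y = the P) \/
    (~ (exists z, P z /\ forall y, P y -> y = z) /\ the P = dflt).
Proof.
  apply (epsilon_spec universe_inhabited (fun x => (P x /\ forall y, P y -> y = x) \/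
    (~ (exists z, P z /\ forall y, P y -> y = z) /\ x = dflt))).
  destruct (classic (exists z, P z /\ forall y, P y -> y = z)) as [[z Hz]|H];
    eauto.
Qed.

Lemma the_spec (P : V -> Prop) :
  (exists x, P x /\ forall y, P y -> y = x) -> P (the P).
Proof. intros H. destruct (the_cases P); tauto. Qed.

Lemma the_eq (P : V -> Prop) (x : V) :
  P x -> (forall y, P y -> y = x) -> the P = x.
Proof. intros Hx H. apply H, the_spec. eauto. Qed.

Lemma definable_the (P : env -> V -> Prop) :
  definable (fun e => P (fun n => e (S n)) (e 0)) ->
  definable_term (fun e => the (P e)).
Proof.
  intros H. unfold definable_term.
  assert (H1 : definable (fun e => P (fun n => e (S (S n))) (e 0))).
  { exact (definable_ren (fun n => match n with 0 => 0 | S m => S (S m) end) _ H). }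
  assert (H2 : definable (fun e => P (fun n => e (S (S (S n)))) (e 0))).
  { exact (definable_ren (fun n => match n with 0 => 0 | S m => S (S (S m)) end) _ H). }
  apply (definable_iff _ (fun e =>
    (P (fun n => e (S n)) (e 0) /\
     forall y, P (fun n => e (S n)) y -> y = e 0) \/
    (~ (exists z, P (fun n => e (S n)) z /\
        forall y, P (fun n => e (S n)) y -> y = z) /\ e 0 = dflt))).
  - apply definable_or; apply definable_and.
    + exact H.
    + apply definable_all, definable_imp; [exact H1|].
      apply definable_eq; apply definable_term_var.
    + apply definable_not, definable_ex, definable_and; [exact H1|].
      apply definable_all, definable_imp; [exact H2|].
      apply definable_eq; apply definable_term_var.
    + apply definable_eq; [apply definable_term_var | apply definable_term_const].
  - intros e. set (Q := P (fun n => e (S n))).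
    destruct (the_cases Q) as [[A B]|[A B]]; split.
    + intros ->. tauto.
    + intros [[C _]|[C _]]; [now apply B | exfalso; apply C; eauto].
    + rewrite B. tauto.
    + rewrite B. intros [C|[_ C]]; [exfalso; apply A; eauto | exact C].
Qed.

Ltac head t := lazymatch t with ?f _ => head f | _ => t end.

Ltac unfold_head t :=
  let b := eval cbv beta in (t (fun _ => dflt)) in
  let h := head b in unfold h.

(* extended below with the rules for pairs and values of functions *)
Ltac dfn_ext := fail.
Ltac dfn_step := first
  [ assumption
  | match goal with
    | H : definable_fun ?F |- definable_term (fun e => ?F (@?t e)) =>
        apply (definable_term_fun F t H)
    | H : definable1 ?R |- definable (fun e => ?R (@?t e)) =>
        apply (definable_rel1 R t H)
    | H : definable2 ?R |- definable (fun e => ?R (@?t e) (@?u e)) =>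
        apply (definable_rel2 R t u H)
    end
  | dfn_ext
  | lazymatch goal with
    | |- definable (fun _ => ?A) => apply (definable_const A)
    | |- definable (fun e => @?P e /\ @?Q e) => apply (definable_and P Q)
    | |- definable (fun e => @?P e \/ @?Q e) => apply (definable_or P Q)
    | |- definable (fun e => @?P e <-> @?Q e) => apply (definable_equiv P Q)
    | |- definable (fun e => ~ @?P e) => apply (definable_not P)
    | |- definable (fun e => ex (@?P e)) => apply (definable_ex P)
    | |- definable (fun e => forall x : V, @?P e x) => apply (definable_all P)
    | |- definable (fun e => @?P e -> @?Q e) => apply (definable_imp P Q)
    | |- definable (fun e => @?t e = @?u e) => apply (definable_eq t u)
    | |- definable (fun e => @?t e ∈ @?u e) => apply (definable_mem t u)
    | |- definable ?P => unfold_head P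
    | |- definable_term (fun e => e ?i) => apply (definable_term_var i)
    | |- definable_term (fun _ => ?c) => apply (definable_term_const c)
    | |- definable_term (fun e => the (fun x => @?P e x)) => apply (definable_the P)
    | |- definable_term ?t => unfold_head t
    end ].

(** [dfn] proves that a predicate or a term is definable, by descending through
    its syntax and unfolding the notions for which there is no rule.  An operation
    or relation with an unknown body must come with a definability hypothesis. *)
Ltac dfn := intros; unfold definable1, definable2, definable_fun;
  repeat (cbv beta; dfn_step).

(** * Basic set operations *)

Lemma set_ext (a b : V) : (forall x, x ∈ a <-> x ∈ b) -> a = b.
Proof. apply (zf_extensionality E HZF). Qed.

Lemma is_set_of_unique (P : V -> Prop) (a b : V) :
  is_set_of E a P -> is_set_of E b P -> a = b.
Proof. intros Ha Hb. apply set_ext. intros x. rewrite (Ha x), (Hb x). tauto. Qed.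

Lemma the_set (P : V -> Prop) (s : V) :
  is_set_of E s P -> is_set_of E (the (fun s => is_set_of E s P)) P.
Proof.
  intros H. apply (the_spec (fun s => is_set_of E s P)).
  exists s. split; [exact H|]. intros y Hy. eapply is_set_of_unique; eassumption.
Qed.

(** The subset of [a] given by [P]; meaningful when [P] is definable. *)
Definition sep (a : V) (P : V -> Prop) : V :=
  the (fun s => is_set_of E s (fun x => x ∈ a /\ P x)).

Lemma in_sep (a : V) (P : V -> Prop) :
  definable1 P -> forall x, x ∈ sep a P <-> x ∈ a /\ P x.
Proof.
  intros (p & f & H). destruct (sat_bind p f) as (p' & f' & H').
  destruct (zf_separation E HZF p' (lookup f' (fun _ => a)) a) as [b Hb].
  apply (the_set (fun x => x ∈ a /\ P x) b).
  intros x. rewrite (Hb x), H'. now rewrite <- (H (scons x (fun _ => a))).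
Qed.

(** Unordered pairs, unions and power sets. *)
Definition upair (a b : V) : V := the (fun s => is_upair E s a b).
Definition union (s : V) : V := the (fun u => is_union E u s).
Definition power (a : V) : V := the (fun p => is_powerset E p a).

Lemma in_upair a b x : x ∈ upair a b <-> x = a \/ x = b.
Proof.
  destruct (zf_pairing E HZF a b) as [p Hp]. revert x.
  exact (the_set _ p Hp).
Qed.

Lemma in_union s x : x ∈ union s <-> exists y, y ∈ s /\ x ∈ y.
Proof.
  destruct (zf_union E HZF s) as [p Hp]. revert x. exact (the_set _ p Hp).
Qed.

Lemma in_power a x : x ∈ power a <-> subset E x a.
Proof.
  destruct (zf_powerset E HZF a) as [p Hp]. revert x. exact (the_set _ p Hp).
Qed.

(** Binary unions and intersections. *)
Definition binunion (a b : V) : V := union (upair a b).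

Lemma in_binunion a b x : x ∈ binunion a b <-> x ∈ a \/ x ∈ b.
Proof.
  unfold binunion. rewrite in_union. split.
  - intros (y & Hy & Hx). apply in_upair in Hy. destruct Hy; subst; auto.
  - intros [H|H]; [exists a | exists b]; (split; [apply in_upair; auto | exact H]).
Qed.

Definition inter (a b : V) : V := sep a (fun x => x ∈ b).

Lemma in_inter a b x : x ∈ inter a b <-> x ∈ a /\ x ∈ b.
Proof. revert x. apply (in_sep a (fun x => x ∈ b)). dfn. Qed.

(** * Ordered pairs and functions *)

(** Kuratowski pairs. *)
Definition opair (a b : V) : V := upair (upair a a) (upair a b).

Lemma is_upair_iff p a b : is_upair E p a b <-> p = upair a b.
Proof.
  split.
  - intros H. apply set_ext. intros x. rewrite (H x), in_upair. tauto.
  - intros -> x. apply in_upair.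
Qed.

Lemma is_opair_iff p a b : is_opair E p a b <-> p = opair a b.
Proof.
  assert (H : is_opair E (opair a b) a b).
  { intros z. unfold opair. now rewrite !is_upair_iff, in_upair. }
  split; [|now intros ->]. intros H'. eapply is_set_of_unique; eassumption.
Qed.

Lemma upair_inj a b c d :
  upair a b = upair c d -> (a = c /\ b = d) \/ (a = d /\ b = c).
Proof.
  intros H.
  assert (Ha : a ∈ upair c d) by (rewrite <- H; apply in_upair; auto).
  assert (Hb : b ∈ upair c d) by (rewrite <- H; apply in_upair; auto).
  assert (Hc : c ∈ upair a b) by (rewrite H; apply in_upair; auto).
  assert (Hd : d ∈ upair a b) by (rewrite H; apply in_upair; auto).
  apply in_upair in Ha, Hb, Hc, Hd.
  destruct Ha; subst; intuition congruence.
Qed.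

Lemma opair_inj a b c d : opair a b = opair c d -> a = c /\ b = d.
Proof.
  intros H. apply upair_inj in H.
  destruct H as [[H1 H2]|[H1 H2]]; apply upair_inj in H1, H2; intuition congruence.
Qed.

Lemma value_iff f x y : value E f x y <-> opair x y ∈ f.
Proof.
  unfold value. split.
  - intros (p & Hp & H). apply is_opair_iff in Hp. now subst.
  - intros H. exists (opair x y). now rewrite is_opair_iff.
Qed.

Lemma definable_opair t u :
  definable_term t -> definable_term u -> definable_term (fun e => opair (t e) (u e)).
Proof.
  intros Ht Hu.
  apply (definable_rel3 (fun p a b => p = opair a b) (fun e => e 0)).
  - apply (definable_iff _ (fun e => is_opair E (e 0) (e 1) (e 2))).
    + dfn.
    + intros e. symmetry. apply is_opair_iff.
  - apply definable_term_var.
  - now apply definable_term_tail.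
  - now apply definable_term_tail.
Qed.

Lemma definable_value t u v :
  definable_term t -> definable_term u -> definable_term v ->
  definable (fun e => value E (t e) (u e) (v e)).
Proof.
  intros Ht Hu Hv. apply (definable_rel3 (value E)); [|assumption..]. dfn.
Qed.

Ltac dfn_ext ::= lazymatch goal with
  | |- definable (fun e => value E (@?t e) (@?u e) (@?v e)) =>
      apply (definable_value t u v)
  | |- definable_term (fun e => opair (@?t e) (@?u e)) =>
      apply (definable_opair t u)
  end.

(** The Cartesian product, separated from the double power set of the union. *)
Definition prod (a b : V) : V :=
  sep (power (power (binunion a b)))
    (fun z => exists x y, x ∈ a /\ y ∈ b /\ z = opair x y).

Lemma in_prod a b z :
  z ∈ prod a b <-> exists x y, x ∈ a /\ y ∈ b /\ z = opair x y.
Proof.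
  unfold prod. rewrite in_sep by dfn. split; [tauto|].
  intros H. split; [|exact H]. destruct H as (x & y & Hx & Hy & ->).
  apply in_power. intros s Hs. apply in_power. intros t Ht.
  apply in_upair in Hs. apply in_binunion.
  destruct Hs as [-> | ->]; apply in_upair in Ht; destruct Ht as [-> | ->]; auto.
Qed.

Lemma opair_in_prod a b x y : opair x y ∈ prod a b <-> x ∈ a /\ y ∈ b.
Proof.
  rewrite in_prod. split.
  - intros (x' & y' & Hx & Hy & H). apply opair_inj in H as [-> ->]. auto.
  - intros [Hx Hy]. eauto 10.
Qed.

Lemma is_product_iff p a b : is_product E p a b <-> p = prod a b.
Proof.
  assert (H : is_product E (prod a b) a b).
  { intros z. rewrite in_prod.
    split; intros (x & y & Hx & Hy & Hz); exists x, y; rewrite is_opair_iff in *; auto. }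
  split; [|now intros ->]. intros H'. eapply is_set_of_unique; eassumption.
Qed.

(** The value of the function [f] at [x]. *)
Definition app (f x : V) : V := the (fun y => value E f x y).

Lemma app_spec f a x : function_on E f a -> x ∈ a -> value E f x (app f x).
Proof.
  intros [_ Hf] Hx. destruct (Hf x Hx) as (y & Hy & Hu).
  apply (the_spec (fun y => value E f x y)). exists y. split; [exact Hy|].
  intros z Hz. symmetry. now apply Hu.
Qed.

Lemma function_domain f a x y : function_on E f a -> value E f x y -> x ∈ a.
Proof.
  intros [Hf _] H. apply value_iff in H. destruct (Hf _ H) as (x' & y' & Hx & Hp).
  apply is_opair_iff, opair_inj in Hp as [-> _]. exact Hx.
Qed.

Lemma app_eq f a x y : function_on E f a -> value E f x y -> y = app f x.
Proof.
  intros Hf H. pose proof (function_domain _ _ _ _ Hf H) as Hx.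
  destruct (proj2 Hf x Hx) as (z & Hz & Hu).
  rewrite <- (Hu y H). apply Hu. now apply (app_spec f a).
Qed.

Lemma app_in f a b x : maps_to E f a b -> x ∈ a -> app f x ∈ b.
Proof. intros [Hf Hb] Hx. apply (Hb x). now apply (app_spec f a). Qed.

(** A definable operation restricted to a set is a set, by Separation in the
    product of the domain with a set that contains the values. *)
Lemma function_exists (F : V -> V) (a b : V) :
  definable_fun F -> (forall x, x ∈ a -> F x ∈ b) ->
  exists f, maps_to E f a b /\ forall x y, value E f x y <-> x ∈ a /\ y = F x.
Proof.
  intros HF Hb.
  exists (sep (prod a b) (fun p => exists x, p = opair x (F x))).
  assert (H : forall x y, value E
    (sep (prod a b) (fun p => exists x, p = opair x (F x))) x y <->
    x ∈ a /\ y = F x).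
  { intros x y. rewrite value_iff, in_sep, opair_in_prod by dfn. split.
    - intros [[Hx Hy] [x' Hx']]. apply opair_inj in Hx' as [-> ->]. auto.
    - intros [Hx ->]. eauto. }
  split; [|exact H]. split; [split|].
  - intros p Hp. apply in_sep in Hp; [|dfn]. destruct Hp as [Hp [x ->]].
    exists x, (F x). apply opair_in_prod in Hp. now rewrite is_opair_iff.
  - intros x Hx. exists (F x). split; [now apply H|].
    intros y Hy. symmetry. now apply H.
  - intros x y Hy. apply H in Hy as [Hx ->]. auto.
Qed.

(** * Natural numbers *)

(** The least inductive set. *)
Definition omega : V := the (is_omega E).

Lemma omega_spec : is_omega E omega.
Proof.
  apply (the_spec (is_omega E)). destruct (zf_infinity E HZF) as [I HI].
  assert (D : definable1 (fun n => forall u, inductive_set E u -> n ∈ u)) by dfn.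
  exists (sep I (fun n => forall u, inductive_set E u -> n ∈ u)). split.
  - split.
    + split.
      * destruct HI as [(z & Hz & HzI) _]. exists z. split; [exact Hz|].
        apply in_sep; [exact D|]. split; [exact HzI|].
        intros u [(z' & Hz' & Hu) _]. replace z with z'; [exact Hu|].
        apply set_ext. intros x. split; intros H; exfalso;
          [apply (Hz' x H) | apply (Hz x H)].
      * intros n Hn. apply in_sep in Hn; [|exact D]. destruct Hn as [HnI Hn].
        destruct (proj2 HI n HnI) as (s & Hs & HsI). exists s. split; [exact Hs|].
        apply in_sep; [exact D|]. split; [exact HsI|].
        intros u Hu. destruct (proj2 Hu n (Hn u Hu)) as (s' & Hs' & Hsu).
        replace s with s'; [exact Hsu|]. eapply is_set_of_unique; eassumption.
    + intros u Hu n Hn. apply in_sep in Hn; [|exact D]. now apply Hn.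
  - intros w [Hw Hmin]. apply set_ext. intros n. rewrite in_sep by exact D. split.
    + intros Hn. split; [now apply Hmin|]. intros u Hu. now apply (Hmin u Hu).
    + intros [_ Hn]. now apply Hn.
Qed.

Lemma is_omega_iff w : is_omega E w <-> w = omega.
Proof.
  split; [|intros ->; apply omega_spec]. intros [Hw Hm].
  destruct omega_spec as [Ho Hm']. apply set_ext. intros n. split.
  - now apply (Hm omega).
  - now apply (Hm' w).
Qed.

Lemma natural_iff n : natural E n <-> n ∈ omega.
Proof.
  unfold natural. split.
  - intros (w & Hw & Hn). apply is_omega_iff in Hw. now subst.
  - intros H. exists omega. split; [apply omega_spec | exact H].
Qed.

(** Von Neumann numerals. *)
Definition zero : V := the (is_empty E).
Definition succ (n : V) : V := binunion n (upair n n).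

Lemma in_succ n x : x ∈ succ n <-> x ∈ n \/ x = n.
Proof. unfold succ. rewrite in_binunion, in_upair. tauto. Qed.

Lemma zero_spec : is_empty E zero.
Proof.
  apply (the_spec (is_empty E)).
  destruct omega_spec as [[(z & Hz & _) _] _]. exists z. split; [exact Hz|].
  intros y Hy. apply set_ext. intros x.
  split; intros H; exfalso; [apply (Hy x H) | apply (Hz x H)].
Qed.

Lemma empty_eq a : is_empty E a -> a = zero.
Proof.
  intros Ha. apply set_ext. intros x.
  split; intros H; exfalso; [apply (Ha x H) | apply (zero_spec x H)].
Qed.

Lemma zero_omega : zero ∈ omega.
Proof.
  destruct omega_spec as [[(z & Hz & H) _] _].
  now rewrite <- (empty_eq z Hz).
Qed.

Lemma is_succ_iff s n : is_succ E s n <-> s = succ n.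
Proof.
  assert (H : is_succ E (succ n) n) by (intros x; apply in_succ).
  split; [|now intros ->]. intros H'. eapply is_set_of_unique; eassumption.
Qed.

Lemma succ_omega n : n ∈ omega -> succ n ∈ omega.
Proof.
  intros Hn. destruct omega_spec as [[_ H] _]. destruct (H n Hn) as (s & Hs & Hso).
  apply is_succ_iff in Hs. now subst.
Qed.

(** Induction is restricted to definable predicates. *)
Lemma omega_ind (P : V -> Prop) : definable1 P ->
  P zero -> (forall n, n ∈ omega -> P n -> P (succ n)) ->
  forall n, n ∈ omega -> P n.
Proof.
  intros HP H0 HS n Hn.
  assert (H : n ∈ sep omega P); [|now apply in_sep in H].
  apply (proj2 omega_spec); [|exact Hn]. split.
  - exists zero. split; [exact zero_spec|]. apply in_sep; auto using zero_omega.
  - intros m Hm. apply in_sep in Hm; [|exact HP]. destruct Hm as [Hm HPm].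
    exists (succ m). split; [now apply is_succ_iff|].
    apply in_sep; auto using succ_omega.
Qed.

Lemma mem_irrefl x : ~ x ∈ x.
Proof.
  intros H. destruct (zf_foundation E HZF (upair x x)) as (y & Hy & Hm).
  - exists x. apply in_upair. auto.
  - apply in_upair in Hy. assert (y = x) as -> by tauto.
    apply (Hm x); [apply in_upair; auto | exact H].
Qed.

Lemma nat_transitive n : n ∈ omega -> forall m k, m ∈ n -> k ∈ m -> k ∈ n.
Proof.
  revert n. apply (omega_ind (fun n => forall m k, m ∈ n -> k ∈ m -> k ∈ n)).
  - dfn.
  - intros m k Hm. destruct (zero_spec m Hm).
  - intros n Hn IH m k Hm Hk. apply in_succ in Hm. apply in_succ.
    destruct Hm as [Hm | ->]; eauto.
Qed.

Lemma omega_transitive n : n ∈ omega -> forall m, m ∈ n -> m ∈ omega.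
Proof.
  revert n. apply (omega_ind (fun n => forall m, m ∈ n -> m ∈ omega)).
  - dfn.
  - intros m Hm. destruct (zero_spec m Hm).
  - intros n Hn IH m Hm. apply in_succ in Hm. destruct Hm as [Hm | ->]; eauto.
Qed.

Lemma succ_le m : m ∈ omega -> forall n, n ∈ m -> succ n ∈ m \/ succ n = m.
Proof.
  revert m. apply (omega_ind (fun m => forall n, n ∈ m -> succ n ∈ m \/ succ n = m)).
  - dfn.
  - intros n Hn. destruct (zero_spec n Hn).
  - intros m Hm IH n Hn. apply in_succ in Hn. rewrite in_succ.
    destruct Hn as [Hn | ->]; [|auto]. destruct (IH n Hn); auto.
Qed.

Lemma nat_trichotomy n :
  n ∈ omega -> forall m, m ∈ omega -> m ∈ n \/ m = n \/ n ∈ m.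
Proof.
  revert n.
  apply (omega_ind (fun n => forall m, m ∈ omega -> m ∈ n \/ m = n \/ n ∈ m)).
  - dfn.
  - intros m Hm. cut (m = zero \/ zero ∈ m); [tauto|]. revert m Hm.
    apply omega_ind; [dfn | auto |]. intros n Hn [-> | H]; right; apply in_succ; auto.
  - intros n Hn IH m Hm. rewrite in_succ.
    destruct (IH m Hm) as [H|[H|H]]; auto. destruct (succ_le m Hm n H); auto.
Qed.

Lemma omega_well_ordered : strict_well_order E omega E.
Proof.
  split; [|split; [|split]].
  - intros x _. apply mem_irrefl.
  - intros x y z _ _ Hz Hxy Hyz. now apply (nat_transitive z Hz y).
  - intros x y Hx Hy. now apply nat_trichotomy.
  - intros b Hb Hne. destruct (zf_foundation E HZF b Hne) as (m & Hm & Hmin).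
    exists m. split; [exact Hm|]. intros x Hx.
    destruct (nat_trichotomy m (Hb m Hm) x (Hb x Hx)) as [H|[H|H]]; auto.
    destruct (Hmin x Hx H).
Qed.

Lemma omega_ordinal : ordinal E omega.
Proof.
  split; [|exact omega_well_ordered]. intros n Hn m. now apply omega_transitive.
Qed.

Lemma succ_inj m n : succ m = succ n -> m = n.
Proof.
  intros H.
  assert (Hm : m ∈ succ n) by (rewrite <- H; apply in_succ; auto).
  assert (Hn : n ∈ succ m) by (rewrite H; apply in_succ; auto).
  apply in_succ in Hm, Hn. destruct Hm as [Hm|]; [|assumption].
  destruct Hn as [Hn|]; [|auto]. exfalso.
  destruct (zf_foundation E HZF (upair m n)) as (y & Hy & Hmin).
  - exists m. apply in_upair. auto.
  - apply in_upair in Hy. destruct Hy as [-> | ->].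
    + apply (Hmin n); [apply in_upair; auto | exact Hn].
    + apply (Hmin m); [apply in_upair; auto | exact Hm].
Qed.

Lemma zero_ne_succ n : zero <> succ n.
Proof. intros H. apply (zero_spec n). rewrite H. apply in_succ. auto. Qed.

(** The recursion theorem: the sequence is the least relation that contains
    [(0, a)] and is closed under [(n, y) |-> (n + 1, F y)]. *)
Lemma recursion (F : V -> V) (Y a : V) :
  definable_fun F -> a ∈ Y -> (forall y, y ∈ Y -> F y ∈ Y) ->
  exists g, maps_to E g omega Y /\ app g zero = a /\
    forall n, n ∈ omega -> app g (succ n) = F (app g n).
Proof.
  intros HF Ha HY.
  pose (cl := fun q => opair zero a ∈ q /\ forall n y, n ∈ omega -> y ∈ Y ->
    opair n y ∈ q -> opair (succ n) (F y) ∈ q).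
  pose (r := sep (prod omega Y) (fun p => forall q, cl q -> p ∈ q)).
  assert (Dr : definable1 (fun p => forall q, cl q -> p ∈ q)) by (unfold cl; dfn).
  assert (R0 : opair zero a ∈ r).
  { apply in_sep; [exact Dr|]. rewrite opair_in_prod.
    split; [split; [exact zero_omega | exact Ha]|]. intros q [Hq _]. exact Hq. }
  assert (RS : forall n y, opair n y ∈ r -> opair (succ n) (F y) ∈ r).
  { intros n y H. apply in_sep in H; [|exact Dr]. destruct H as [H Hq].
    apply opair_in_prod in H as [Hn Hy].
    apply in_sep; [exact Dr|]. rewrite opair_in_prod.
    split; [split; [now apply succ_omega | now apply HY]|].
    intros q Cq. apply Cq; auto. }
  (* otherwise [r] without this pair would still be closed under the rules *)
  assert (Rm : forall n y, opair n y ∈ r ->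
    opair zero a <> opair n y ->
    exists m z, opair m z ∈ r /\ opair (succ m) (F z) = opair n y).
  { intros n y H Hz. apply NNPP. intros Hno.
    assert (C : cl (sep r (fun p => p <> opair n y))).
    { split.
      - apply in_sep; [dfn|]. auto.
      - intros m z Hm HzY H'. apply in_sep in H'; [|dfn]. destruct H' as [H' _].
        apply in_sep; [dfn|]. split; [auto|]. intros He. apply Hno. eauto. }
    apply in_sep in H; [|exact Dr]. apply (proj2 H) in C.
    apply in_sep in C; [|dfn]. now apply C. }
  assert (RF : forall n, n ∈ omega ->
    exists y, opair n y ∈ r /\ forall z, opair n z ∈ r -> z = y).
  { apply omega_ind; [dfn| |].
    - exists a. split; [exact R0|]. intros z Hz. apply NNPP. intros Hne.
      destruct (Rm zero z Hz) as (m & y & _ & He).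
      + intros He. apply opair_inj in He as [_ He]. auto.
      + apply opair_inj in He as [He _]. symmetry in He. now apply zero_ne_succ in He.
    - intros n Hn (y & Hy & Hu). exists (F y). split; [now apply RS|].
      intros z Hz. destruct (Rm (succ n) z Hz) as (m & y' & Hy' & He).
      + intros He. apply opair_inj in He as [He _]. now apply zero_ne_succ in He.
      + apply opair_inj in He as [He <-]. apply succ_inj in He. subst m.
        f_equal. now apply Hu. }
  assert (Hf : maps_to E r omega Y).
  { split; [split|].
    - intros p Hp. apply in_sep in Hp; [|exact Dr]. destruct Hp as [Hp _].
      apply in_prod in Hp as (x & y & Hx & Hy & ->). exists x, y.
      now rewrite is_opair_iff.
    - intros n Hn. destruct (RF n Hn) as (y & Hy & Hu). exists y.
      split; [now apply value_iff|]. intros z Hz. symmetry.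
      apply Hu. now apply value_iff.
    - intros x y H. apply value_iff, in_sep in H; [|exact Dr].
      destruct H as [H _]. now apply opair_in_prod in H. }
  exists r. split; [exact Hf|]. split.
  - symmetry. apply (app_eq r omega); [apply Hf | now apply value_iff].
  - intros n Hn. symmetry. apply (app_eq r omega); [apply Hf|].
    apply value_iff, RS, value_iff. apply (app_spec r omega); [apply Hf | exact Hn].
Qed.

(** * Well-orderings and countable sets *)

Lemma well_order_least (I : V) (lt : V -> V -> Prop) (P : V -> Prop) :
  strict_well_order E I lt -> definable1 P -> (exists i, i ∈ I /\ P i) ->
  exists i, (i ∈ I /\ P i /\ forall i', i' ∈ I -> P i' -> i = i' \/ lt i i') /\
    forall k, (k ∈ I /\ P k /\ forall i', i' ∈ I -> P i' -> k = i' \/ lt k i') -> k = i.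
Proof.
  intros (Hirr & Htr & _ & Hwf) HP (i & Hi & Hp).
  destruct (Hwf (sep I P)) as (m & Hm & Hl).
  - intros x Hx. now apply in_sep in Hx.
  - exists i. now apply in_sep.
  - apply in_sep in Hm; [|exact HP]. destruct Hm as [HmI HmP]. exists m. split.
    + split; [exact HmI|]. split; [exact HmP|].
      intros i' Hi' HP'. apply Hl. now apply in_sep.
    + intros k (HkI & HkP & Hk). destruct (Hk m HmI HmP) as [|H1]; [assumption|].
      destruct (Hl k) as [H2|H2]; [now apply in_sep | auto |].
      exfalso. apply (Hirr k HkI). now apply (Htr k m k).
Qed.

(** The first element of the well-ordered set [I] that satisfies [P]. *)
Definition least (I : V) (lt : V -> V -> Prop) (P : V -> Prop) : V :=
  the (fun i => i ∈ I /\ P i /\ forall i', i' ∈ I -> P i' -> i = i' \/ lt i i').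

Lemma least_spec (I : V) (lt : V -> V -> Prop) (P : V -> Prop) :
  strict_well_order E I lt -> definable1 P -> (exists i, i ∈ I /\ P i) ->
  least I lt P ∈ I /\ P (least I lt P) /\
    forall i, i ∈ I -> P i -> least I lt P = i \/ lt (least I lt P) i.
Proof.
  intros Hw HP He. unfold least.
  apply (the_spec (fun i => i ∈ I /\ P i /\
    forall i', i' ∈ I -> P i' -> i = i' \/ lt i i')).
  now apply well_order_least.
Qed.

(** The ordering of a set through an injection [j] into [omega]. *)
Definition index_lt (j x y : V) : Prop :=
  exists m n, value E j x m /\ value E j y n /\ m ∈ n.

Lemma index_lt_definable j : definable2 (index_lt j).
Proof. unfold index_lt. dfn. Qed.

Lemma index_lt_well_order j a :
  injection E j a omega -> strict_well_order E a (index_lt j).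
Proof.
  intros [[Hf Ho] Hinj].
  assert (Hv : forall x y, x ∈ a -> y ∈ a ->
    (index_lt j x y <-> app j x ∈ app j y)).
  { intros x y Hx Hy. split.
    - intros (m & n & Hm & Hn & H).
      apply (app_eq _ _ _ _ Hf) in Hm, Hn. now subst.
    - intros H. exists (app j x), (app j y). eauto using app_spec. }
  assert (HO : forall x, x ∈ a -> app j x ∈ omega).
  { intros x Hx. now apply (app_in j a). }
  destruct omega_well_ordered as (Hirr & Htr & Htot & Hwf).
  split; [|split; [|split]].
  - intros x Hx H. apply Hv in H; [|assumption..]. now apply mem_irrefl in H.
  - intros x y z Hx Hy Hz H1 H2. apply Hv in H1, H2; [|assumption..].
    apply Hv; [assumption..|]. now apply (Htr _ (app j y)); auto.
  - intros x y Hx Hy. rewrite !Hv by assumption.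
    destruct (Htot (app j x) (app j y)) as [H|[H|H]]; auto.
    right. left. apply (Hinj x y (app j x)); [|rewrite H]; now apply (app_spec j a).
  - intros b Hb [x0 Hx0].
    destruct (Hwf (sep omega (fun n => exists x, x ∈ b /\ value E j x n)))
      as (m & Hm & Hmin).
    + intros n Hn. apply in_sep in Hn; [tauto | dfn].
    + exists (app j x0). apply in_sep; [dfn|]. eauto 10 using app_spec.
    + apply in_sep in Hm; [|dfn]. destruct Hm as [Hm (x & Hx & Hj)].
      exists x. split; [exact Hx|]. intros y Hy.
      rewrite Hv by auto. apply (app_eq _ _ _ _ Hf) in Hj. subst m.
      destruct (Hmin (app j y)) as [H|H].
      * apply in_sep; [dfn|]. eauto 10 using app_spec.
      * left. apply (Hinj x y (app j x)); [|rewrite H]; apply (app_spec j a); auto.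
      * auto.
Qed.

Lemma countable_iff a : countable E a <-> exists j, injection E j a omega.
Proof.
  split.
  - intros (w & j & Hw & Hj). apply is_omega_iff in Hw. subst. eauto.
  - intros [j Hj]. exists omega, j. split; [exact omega_spec | exact Hj].
Qed.

Lemma countable_well_orderable a : countable E a -> well_orderable E a.
Proof.
  intros H. apply countable_iff in H as [j Hj].
  pose proof (index_lt_definable j) as Dj.
  exists (sep (prod a a) (fun p => exists x y, p = opair x y /\ index_lt j x y)).
  set (r := sep _ _).
  assert (Hr : forall x y, x ∈ a -> y ∈ a -> (value E r x y <-> index_lt j x y)).
  { intros x y Hx Hy. unfold r. rewrite value_iff, in_sep, opair_in_prod by dfn. split.
    - intros [_ (x' & y' & He & H)]. apply opair_inj in He as [-> ->]. exact H.
    - intros H. eauto 10. }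
  destruct (index_lt_well_order j a Hj) as (H1 & H2 & H3 & H4).
  split; [|split; [|split]].
  - intros x Hx. rewrite Hr by assumption. auto.
  - intros x y z Hx Hy Hz. rewrite !Hr by assumption. eauto.
  - intros x y Hx Hy. rewrite !Hr by assumption. eauto.
  - intros b Hb Hne. destruct (H4 b Hb Hne) as (m & Hm & Hl). exists m.
    split; [exact Hm|]. intros x Hx. rewrite Hr by auto. auto.
Qed.

(** An element of the image is represented by the least index of its preimages,
    so that no choice is made. *)
Lemma countable_image (F : V -> V) (a b : V) :
  definable_fun F -> countable E a -> (forall y, y ∈ b -> exists x, x ∈ a /\ y = F x) ->
  countable E b.
Proof.
  intros HF Ha Hb. apply countable_iff in Ha as [j Hj].
  pose (idx := fun y => least omega E (fun n => exists x, value E j x n /\ y = F x)).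
  assert (Hidx : forall y, y ∈ b -> idx y ∈ omega /\
    exists x, value E j x (idx y) /\ y = F x).
  { intros y Hy. destruct (Hb y Hy) as (x & Hx & HyF).
    destruct (least_spec omega E (fun n => exists x, value E j x n /\ y = F x))
      as (H1 & H2 & _); [exact omega_well_ordered | dfn | |split; assumption].
    exists (app j x). split; [now apply (app_in j a); [apply Hj|]|].
    exists x. split; [apply (app_spec j a); [apply Hj | exact Hx] | exact HyF]. }
  destruct (function_exists idx b omega) as (f & Hf & Hv).
  - unfold idx, least. dfn.
  - intros y Hy. now apply Hidx.
  - apply countable_iff. exists f. split; [exact Hf|].
    intros y y' n H1 H2. apply Hv in H1 as [Hy H1]. apply Hv in H2 as [Hy' H2].
    destruct (Hidx y Hy) as (_ & x & Hx & ->).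
    destruct (Hidx y' Hy') as (_ & x' & Hx' & ->).
    f_equal. apply (proj2 Hj x x' n); congruence.
Qed.
(** * Closed sets and sequences *)

(** Every open neighbourhood of [x] meets [S]. *)
Definition adherent (T S x : V) : Prop :=
  forall N, N ∈ T -> x ∈ N -> exists z, z ∈ N /\ z ∈ S.

(** [C] contains its adherent points in [X]: in a topological space this is
    closedness ([closed_iff]). *)
Definition adherent_closed (X T C : V) : Prop :=
  subset E C X /\ forall x, x ∈ X -> adherent T C x -> x ∈ C.

(** The closure of [S] in [X]. *)
Definition closure (X T S : V) : V := sep X (adherent T S).

Lemma in_closure X T S x : x ∈ closure X T S <-> x ∈ X /\ adherent T S x.
Proof. unfold closure. apply in_sep. dfn. Qed.

Lemma adherent_mono T S S' x :
  subset E S S' -> adherent T S x -> adherent T S' x.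
Proof. intros HS H N HN Hx. destruct (H N HN Hx) as (z & Hz & HzS). eauto. Qed.

Lemma member_adherent T S x : x ∈ S -> adherent T S x.
Proof. intros H N _ Hx. eauto. Qed.

Lemma closed_seq_closed X T A : closed_set E X T A -> seq_closed E X T A.
Proof.
  intros (HA & U & HU & HD). split; [exact HA|].
  intros s x (w & Hw & [Hs HsA]) Hx Hc. apply NNPP. intros Hn.
  destruct (Hc U HU) as (m & Hm & H); [apply HD; auto|].
  apply natural_iff in Hm. apply is_omega_iff in Hw. subst w.
  pose proof (app_spec s omega m Hs Hm) as Hv.
  apply (HsA m) in Hv as HvA.
  specialize (H m _ (proj2 (natural_iff m) Hm) (or_intror eq_refl) Hv).
  apply HD in H. tauto.
Qed.

Lemma subspace_exists T A : exists TA, subspace_topology E T A TA.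
Proof.
  exists (sep (power A) (fun W => exists U, U ∈ T /\ W = inter U A)).
  intros W. rewrite in_sep by dfn. rewrite in_power. split.
  - intros [_ (U & HU & ->)]. exists U. split; [exact HU|]. intros x. apply in_inter.
  - intros (U & HU & HW). split; [intros x Hx; now apply HW in Hx|].
    exists U. split; [exact HU|]. apply set_ext. intros x.
    now rewrite (HW x), in_inter.
Qed.

Lemma dense_in_subspace_iff T A D :
  dense_in_subspace E T A D <->
  subset E D A /\ forall x, x ∈ A -> adherent T D x.
Proof.
  split.
  - intros (TA & HTA & HD & Hd). split; [exact HD|]. intros x Hx N HN HxN.
    destruct (Hd (inter N A)) as (z & Hz & HzD).
    + apply HTA. exists N. split; [exact HN|]. intros y. apply in_inter.
    + exists x. now apply in_inter.
    + exists z. apply in_inter in Hz. tauto.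
  - intros [HD Hd]. destruct (subspace_exists T A) as [TA HTA].
    exists TA. split; [exact HTA|]. split; [exact HD|].
    intros W HW [x Hx]. apply HTA in HW as (U & HU & HW).
    apply HW in Hx as [HxU HxA]. destruct (Hd x HxA U HU HxU) as (z & Hz & HzD).
    exists z. split; [apply HW; auto | exact HzD].
Qed.

Section Space.

Context (X T : V) (HT : is_topology E X T).

Lemma open_subset U : U ∈ T -> subset E U X.
Proof. apply HT. Qed.

Lemma whole_open : X ∈ T.
Proof. apply HT. Qed.

Lemma open_inter U W : U ∈ T -> W ∈ T -> inter U W ∈ T.
Proof.
  intros HU HW. destruct HT as (_ & _ & _ & _ & H). apply (H U W); auto.
  intros x. apply in_inter.
Qed.

Lemma open_union S : subset E S T -> union S ∈ T.
Proof.
  intros HS. destruct HT as (_ & _ & _ & H & _). apply (H S); [exact HS|].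
  intros x. apply in_union.
Qed.

Lemma closed_iff C : closed_set E X T C <-> adherent_closed X T C.
Proof.
  split.
  - intros (HC & U & HU & HD). split; [exact HC|].
    intros x Hx H. apply NNPP. intros Hn.
    destruct (H U HU) as (z & Hz & HzC); [apply HD; auto|].
    apply HD in Hz. tauto.
  - intros [HC H]. split; [exact HC|].
    assert (D : definable1 (fun N => forall z, z ∈ N -> ~ z ∈ C)) by dfn.
    exists (union (sep T (fun N => forall z, z ∈ N -> ~ z ∈ C))). split.
    + apply open_union. intros N HN. apply in_sep in HN; [tauto | exact D].
    + intros x. rewrite in_union. split.
      * intros (N & HN & Hx). apply in_sep in HN; [|exact D].
        destruct HN as [HN Hd]. split; [now apply (open_subset N) | auto].
      * intros [Hx Hn]. apply NNPP. intros Hno. apply Hn, H; [exact Hx|].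
        intros N HN HxN. apply NNPP. intros Hne. apply Hno.
        exists N. split; [|exact HxN]. apply in_sep; [exact D|].
        split; [exact HN|]. intros z Hz Hz'. eauto.
Qed.

Lemma adherent_closure S x : adherent T (closure X T S) x -> adherent T S x.
Proof.
  intros H N HN Hx. destruct (H N HN Hx) as (z & Hz & HzS).
  apply in_closure in HzS as [_ HzS]. eauto.
Qed.

Lemma closure_closed S : adherent_closed X T (closure X T S).
Proof.
  split.
  - intros x Hx. now apply in_closure in Hx.
  - intros x Hx H. apply in_closure. split; [exact Hx|]. now apply adherent_closure.
Qed.

Lemma whole_closed : adherent_closed X T X.
Proof. split; [intros x; auto | auto]. Qed.

Lemma inter_closed C D :
  adherent_closed X T C -> adherent_closed X T D -> adherent_closed X T (inter C D).
Proof.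
  intros [HC HC'] [HD HD']. split.
  - intros x Hx. apply in_inter in Hx. now apply HC.
  - intros x Hx H. apply in_inter.
    split; [apply HC' | apply HD']; auto; revert H; apply adherent_mono;
      intros y Hy; now apply in_inter in Hy.
Qed.

Lemma inter_seq_closed A C :
  seq_closed E X T A -> adherent_closed X T C -> seq_closed E X T (inter A C).
Proof.
  intros [HA HA'] HC. apply closed_iff, closed_seq_closed in HC as [_ HC'].
  split.
  - intros x Hx. apply in_inter in Hx. now apply HA.
  - intros s x (w & Hw & [Hs HsA]) Hx Hc. apply in_inter.
    split; [apply (HA' s) | apply (HC' s)]; auto;
      exists w; (split; [exact Hw|]); (split; [exact Hs|]);
      intros n y Hy; apply HsA, in_inter in Hy; tauto.
Qed.

(** A Loeb space has a choice operation on its non-empty closed sets. *)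
Lemma Loeb_choice :
  Loeb E X T -> exists f, forall C, adherent_closed X T C -> nonempty E C ->
    app f C ∈ C.
Proof.
  intros (F & HF & f & Hf & Hc). exists f. intros C HC Hne.
  apply (Hc C), (app_spec f F); [exact Hf|]. apply HF.
  split; [now apply closed_iff | exact Hne].
Qed.

Lemma singleton_F_sigma A : adherent_closed X T A -> F_sigma E X T A.
Proof.
  intros HA. exists (upair A A). split; [|split].
  - destruct (function_exists (fun _ => zero) (upair A A) omega) as (f & Hf & Hv).
    + dfn.
    + intros _ _. exact zero_omega.
    + apply countable_iff. exists f. split; [exact Hf|].
      intros x x' y Hx Hx'. apply Hv in Hx as [Hx _], Hx' as [Hx' _].
      apply in_upair in Hx, Hx'. assert (x = A) by tauto. assert (x' = A) by tauto.
      congruence.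
  - intros F HF. apply in_upair in HF. assert (F = A) as -> by tauto.
    now apply closed_iff.
  - intros x. split.
    + intros Hx. exists A. rewrite in_upair. auto.
    + intros (y & Hy & Hx). apply in_upair in Hy. assert (y = A) as <- by tauto.
      exact Hx.
Qed.

(** From here on [B] is a base indexed by [j], and the space is regular. *)
Context (B j : V) (HB : is_base E T B) (Hj : injection E j B omega).
Context (Hreg : forall U x, U ∈ T -> x ∈ U -> exists O, O ∈ T /\ x ∈ O /\
  forall y, y ∈ X -> adherent T O y -> y ∈ U).

Lemma regular_base U x : U ∈ T -> x ∈ U -> exists W, W ∈ B /\ x ∈ W /\
  forall y, y ∈ X -> adherent T W y -> y ∈ U.
Proof.
  intros HU Hx. destruct (Hreg U x HU Hx) as (O & HO & HxO & Hcl).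
  destruct (proj2 HB O x HO HxO) as (W & HW & HxW & HWO).
  exists W. split; [exact HW|]. split; [exact HxW|].
  intros y Hy H. apply Hcl; [exact Hy|]. revert H. now apply adherent_mono.
Qed.

(** The points that lie in the closure of every basic neighbourhood of [x] of
    index at most [n]: a decreasing sequence of closed neighbourhoods of [x],
    canonical in [x] and [n], that shrinks to [x]. *)
Definition nbhd (n x : V) : V :=
  sep X (fun y => forall W k, W ∈ B -> x ∈ W -> value E j W k -> nat_le E k n ->
    adherent T W y).

Lemma in_nbhd n x y : y ∈ nbhd n x <-> y ∈ X /\
  forall W k, W ∈ B -> x ∈ W -> value E j W k -> nat_le E k n -> adherent T W y.
Proof. unfold nbhd. apply in_sep. dfn. Qed.

Lemma nbhd_closed n x : adherent_closed X T (nbhd n x).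
Proof.
  split.
  - intros y Hy. now apply in_nbhd in Hy.
  - intros y Hy H. apply in_nbhd. split; [exact Hy|].
    intros W k HW Hx Hk Hkn N HN HyN. destruct (H N HN HyN) as (z & Hz & Hzn).
    apply in_nbhd in Hzn as [_ Hzn]. now apply (Hzn W k).
Qed.

(** At most one basic set is added at each index, so that by induction the finite
    intersection of the basic neighbourhoods of index at most [n] is open. *)
Lemma nbhd_open n x : x ∈ X -> n ∈ omega ->
  exists U, U ∈ T /\ x ∈ U /\ subset E U (nbhd n x).
Proof.
  intros Hx Hn.
  cut (exists U, U ∈ T /\ x ∈ U /\ forall W k, W ∈ B -> x ∈ W -> value E j W k ->
    nat_le E k n -> subset E U W).
  { intros (U & HU & HxU & H). exists U. split; [exact HU|]. split; [exact HxU|].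
    intros y Hy. apply in_nbhd. split; [now apply (open_subset U)|].
    intros W k HW HxW Hk Hkn. apply member_adherent. now apply (H W k). }
  assert (Hstep : forall (lo : V -> Prop) n U,
    (U ∈ T /\ x ∈ U /\ forall W k, W ∈ B -> x ∈ W -> value E j W k ->
      lo k -> subset E U W) ->
    exists U, U ∈ T /\ x ∈ U /\ forall W k, W ∈ B -> x ∈ W -> value E j W k ->
      lo k \/ k = n -> subset E U W).
  { clear n Hn. intros lo n U (HU & HxU & H).
    destruct (classic (exists W, W ∈ B /\ x ∈ W /\ value E j W n))
      as [(W & HW & HxW & Hk)|Hno].
    - exists (inter U W). split; [|split].
      + apply open_inter; [exact HU | now apply HB].
      + now apply in_inter.
      + intros W' k HW' HxW' Hk' [Hl| ->] y Hy; apply in_inter in Hy as [Hy1 Hy2].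
        * now apply (H W' k).
        * now rewrite (proj2 Hj W' W n).
    - exists U. split; [exact HU|]. split; [exact HxU|].
      intros W' k HW' HxW' Hk' [Hl| ->]; [now apply (H W' k)|].
      exfalso. eauto. }
  revert n Hn. apply omega_ind.
  - dfn.
  - apply (Hstep (fun k => k ∈ zero) zero X).
    split; [exact whole_open|]. split; [exact Hx|].
    intros W k _ _ _ Hk. destruct (zero_spec k Hk).
  - intros n Hn (U & H). apply (Hstep (fun k => k ∈ succ n) (succ n) U).
    destruct H as (HU & HxU & H).
    split; [exact HU|]. split; [exact HxU|]. intros W k HW HxW Hk Hkn.
    apply (H W k); auto. now apply in_succ.
Qed.

Lemma nbhd_small U x : U ∈ T -> x ∈ U ->
  exists m, m ∈ omega /\ forall n, nat_le E m n -> subset E (nbhd n x) U.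
Proof.
  intros HU Hx. destruct (regular_base U x HU Hx) as (W & HW & HxW & Hcl).
  exists (app j W). split; [now apply (app_in j B); [apply Hj|]|].
  intros n Hmn y Hy. apply in_nbhd in Hy as [Hy H]. apply Hcl; [exact Hy|].
  apply (H W (app j W)); auto. apply (app_spec j B); [apply Hj | exact HW].
Qed.

Lemma adherent_nbhd A n x : x ∈ X -> n ∈ omega -> adherent T A x ->
  exists z, z ∈ A /\ z ∈ nbhd n x.
Proof.
  intros Hx Hn H. destruct (nbhd_open n x Hx Hn) as (U & HU & HxU & HUn).
  destruct (H U HU HxU) as (z & Hz & HzA). eauto.
Qed.

Lemma definable_nbhd x : definable_fun (fun n => nbhd n x).
Proof. unfold nbhd. dfn. Qed.

(** A definable selection of points from the neighbourhoods of [x] is a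
    sequence that converges to [x]. *)
Lemma selected_sequence (h : V -> V) (A x : V) :
  definable_fun h -> (forall n, n ∈ omega -> h n ∈ A /\ h n ∈ nbhd n x) ->
  exists s, sequence_in E s A /\ converges E T s x.
Proof.
  intros Hh H. destruct (function_exists h omega A Hh) as (s & Hs & Hv).
  { intros n Hn. now apply H. }
  exists s. split; [exists omega; split; [exact omega_spec | exact Hs]|].
  intros U HU Hx. destruct (nbhd_small U x HU Hx) as (m & Hm & HmU).
  exists m. split; [now apply natural_iff|].
  intros n y Hn Hmn Hy. apply Hv in Hy as [Hn' ->].
  apply (HmU n Hmn). now apply H.
Qed.

(** Let [f] choose points from closed sets, and let [G i] be closed subsets of
    [A] indexed by a well-ordered set.  A point adherent to their union is the
    limit of a sequence in [A]: the [n]-th term is chosen in the intersection of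
    [nbhd n x] with the first of the sets that meets it. *)
Lemma well_ordered_closed_sequence (f I A x : V) (lt : V -> V -> Prop) (G : V -> V) :
  (forall C, adherent_closed X T C -> nonempty E C -> app f C ∈ C) ->
  strict_well_order E I lt -> definable2 lt -> definable_fun G ->
  (forall i, i ∈ I -> adherent_closed X T (G i) /\ subset E (G i) A) ->
  x ∈ X ->
  (forall N, N ∈ T -> x ∈ N -> exists i z, i ∈ I /\ z ∈ N /\ z ∈ G i) ->
  exists s, sequence_in E s A /\ converges E T s x.
Proof.
  intros Hf Hw Dlt DG HG Hx Had.
  pose proof (definable_nbhd x) as Dn.
  pose (i0 := fun n => least I lt (fun i => exists z, z ∈ G i /\ z ∈ nbhd n x)).
  assert (Hi : forall n, n ∈ omega -> i0 n ∈ I /\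
    exists z, z ∈ G (i0 n) /\ z ∈ nbhd n x).
  { intros n Hn.
    destruct (least_spec I lt (fun i => exists z, z ∈ G i /\ z ∈ nbhd n x) Hw)
      as (H1 & H2 & _); [dfn | | now split].
    destruct (nbhd_open n x Hx Hn) as (U & HU & HxU & HUn).
    destruct (Had U HU HxU) as (i & z & Hi & Hz & HzG).
    exists i. split; [exact Hi|]. exists z. auto. }
  assert (Di : definable_fun i0) by (unfold i0, least; dfn).
  apply (selected_sequence (fun n => app f (inter (G (i0 n)) (nbhd n x)))); [dfn|].
  intros n Hn. destruct (Hi n Hn) as (HI & z & HzG & Hzn).
  destruct (HG (i0 n) HI) as [HGc HGA].
  assert (H : app f (inter (G (i0 n)) (nbhd n x)) ∈ inter (G (i0 n)) (nbhd n x)).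
  { apply Hf.
    - apply inter_closed; [exact HGc | apply nbhd_closed].
    - exists z. now apply in_inter. }
  apply in_inter in H as [H1 H2]. auto.
Qed.

(** Every point of the closure of [D] is the limit of the sequence of the first
    elements of [D] in its neighbourhoods. *)
Lemma well_orderable_closure A D :
  seq_closed E X T A -> subset E D A -> well_orderable E D ->
  subset E (closure X T D) A.
Proof.
  intros [HA Hs] HDA [r Hr] x Hx. apply in_closure in Hx as [Hx Had].
  pose proof (definable_nbhd x) as Dn.
  destruct (selected_sequence
    (fun n => least D (value E r) (fun z => z ∈ nbhd n x)) A x) as (s & H1 & H2).
  - unfold least. dfn.
  - intros n Hn.
    destruct (least_spec D (value E r) (fun z => z ∈ nbhd n x) Hr) as (H1 & H2 & _).
    + dfn.
    + now apply adherent_nbhd.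
    + auto.
  - now apply (Hs s x).
Qed.

(** * The equivalence for Loeb spaces *)

Section Equivalence.

Context (HL : Loeb E X T).

Lemma sequential_iff :
  sequential E X T <-> forall A, seq_closed E X T A -> adherent_closed X T A.
Proof.
  split.
  - intros H A HA. now apply closed_iff, H.
  - intros H A. split; [|apply closed_seq_closed].
    intros HA. apply closed_iff. auto.
Qed.

Lemma sequential_separable :
  sequential E X T -> seq_closed_subspaces_separable E X T.
Proof.
  intros Hseq A TA HA HTA. apply (proj1 sequential_iff Hseq) in HA.
  destruct (Loeb_choice HL) as [f Hf].
  pose (h := fun W => app f (inter A (closure X T W))).
  assert (Dh : definable_fun h) by (unfold h; dfn).
  assert (Hh : forall W, (exists x, x ∈ A /\ x ∈ W) ->
    h W ∈ inter A (closure X T W)).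
  { intros W (x & HxA & HxW). apply Hf.
    - apply inter_closed; [exact HA | apply closure_closed].
    - exists x. apply in_inter. split; [exact HxA|]. apply in_closure.
      split; [now apply HA | now apply member_adherent]. }
  pose (D := sep A (fun y => exists W, W ∈ B /\ (exists x, x ∈ A /\ x ∈ W) /\ y = h W)).
  assert (HD : forall y, y ∈ D <-> y ∈ A /\
    exists W, W ∈ B /\ (exists x, x ∈ A /\ x ∈ W) /\ y = h W).
  { apply in_sep. dfn. }
  exists D. split.
  - apply (countable_image h B); [exact Dh | | ].
    + apply countable_iff. eauto.
    + intros y Hy. apply HD in Hy as (_ & W & HW & _ & ->). eauto.
  - split; [intros y Hy; now apply HD in Hy|].
    intros U' HU' [x Hx]. apply HTA in HU' as (U & HU & HU'). apply HU' in Hx as [HxU HxA].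
    destruct (regular_base U x HU HxU) as (W & HW & HxW & Hcl).
    pose proof (Hh W (ex_intro _ x (conj HxA HxW))) as H.
    apply in_inter in H as [H1 H2]. apply in_closure in H2 as [H2 H3].
    exists (h W). split; [apply HU'; auto|]. apply HD. eauto 10.
Qed.

Lemma separable_wo_dense :
  seq_closed_subspaces_separable E X T -> seq_closed_sets_wo_dense E X T.
Proof.
  intros H A HA. destruct (subspace_exists T A) as [TA HTA].
  destruct (H A TA HA HTA) as (D & HDc & HD).
  exists D. split; [apply HD|]. split; [|exists TA; auto].
  destruct (function_exists (fun _ => D) omega (upair D D)) as (g & Hg & Hv).
  - dfn.
  - intros _ _. apply in_upair. auto.
  - exists omega, g. split; [exact omega_ordinal|]. split; [apply Hg|]. split.
    + intros n S HS. apply Hv in HS as [_ ->]. now apply countable_well_orderable.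
    + intros x. split.
      * intros Hx. exists zero, D. rewrite Hv. auto using zero_omega.
      * intros (n & S & HS & Hx). apply Hv in HS as [_ ->]. exact Hx.
Qed.

Lemma wo_dense_sequential :
  seq_closed_sets_wo_dense E X T -> sequential E X T.
Proof.
  intros H. apply (proj2 sequential_iff). intros A HA. split; [apply HA|].
  intros x Hx Had. destruct (H A HA) as (D & HDA & (k & g & Hk & Hg & Hwo & HD) & Hd).
  apply dense_in_subspace_iff in Hd as [_ Hd].
  destruct (Loeb_choice HL) as [f Hf].
  destruct (well_ordered_closed_sequence f k A x E
    (fun i => closure X T (app g i)) Hf (proj2 Hk)) as (s & Hs & Hc).
  - dfn.
  - dfn.
  - intros i Hi. split; [apply closure_closed|].
    pose proof (app_spec g k i Hg Hi) as Hv.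
    apply well_orderable_closure; [exact HA | | now apply (Hwo i)].
    intros y Hy. apply HDA, HD. eauto.
  - exact Hx.
  - intros N HN HxN. destruct (Had N HN HxN) as (z & Hz & HzA).
    destruct (Hd z HzA N HN Hz) as (y & Hy & HyD).
    apply HD in HyD as (i & S & HS & HyS).
    exists i, y. split; [now apply (function_domain g k i S)|]. split; [exact Hy|].
    apply in_closure. split; [now apply (open_subset N)|]. apply member_adherent.
    now rewrite <- (app_eq g k i S).
  - destruct HA as [_ HA]. now apply (HA s).
Qed.

Lemma sequential_choice :
  sequential E X T -> seq_closed_sets_have_choice E X T.
Proof.
  intros H. destruct HL as (F & HF & Hc). exists F. split; [|exact Hc].
  intros A. rewrite (HF A), (H A). tauto.
Qed.

Lemma choice_sequential :
  seq_closed_sets_have_choice E X T -> sequential E X T.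
Proof.
  intros (F & HF & f & Hf & Hc). apply (proj2 sequential_iff). intros A HA.
  split; [apply HA|]. intros x Hx Had.
  pose proof (definable_nbhd x) as Dn.
  destruct (selected_sequence (fun n => app f (inter A (nbhd n x))) A x)
    as (s & Hs & Hcv).
  - dfn.
  - intros n Hn.
    assert (H : app f (inter A (nbhd n x)) ∈ inter A (nbhd n x)).
    { apply (Hc (inter A (nbhd n x))), (app_spec f F); [exact Hf|]. apply HF. split.
      - apply inter_seq_closed; [exact HA | apply nbhd_closed].
      - destruct (adherent_nbhd A n x Hx Hn Had) as (z & Hz).
        exists z. now apply in_inter. }
    now apply in_inter in H.
  - destruct HA as [_ HA]. now apply (HA s).
Qed.

Lemma sequential_F_sigma :
  sequential E X T -> seq_closed_sets_F_sigma E X T.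
Proof.
  intros H A HA. apply singleton_F_sigma. now apply (proj1 sequential_iff H).
Qed.

Lemma F_sigma_F_sigma_dense :
  seq_closed_sets_F_sigma E X T -> seq_closed_sets_F_sigma_dense E X T.
Proof.
  intros H A HA. exists A. split; [intros x; auto|]. split; [auto|].
  apply dense_in_subspace_iff. split; [intros x; auto|].
  intros x. apply member_adherent.
Qed.

Lemma F_sigma_dense_sequential :
  seq_closed_sets_F_sigma_dense E X T -> sequential E X T.
Proof.
  intros H. apply (proj2 sequential_iff). intros A HA. split; [apply HA|].
  intros x Hx Had. destruct (H A HA) as (D & HDA & (C & HC & Hcl & HD) & Hd).
  apply dense_in_subspace_iff in Hd as [_ Hd].
  destruct (Loeb_choice HL) as [f Hf].
  apply countable_iff in HC as [i Hi].
  destruct (well_ordered_closed_sequence f C A x (index_lt i) (fun F => F) Hf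
    (index_lt_well_order i C Hi) (index_lt_definable i)) as (s & Hs & Hc).
  - dfn.
  - intros F HF. split; [now apply closed_iff, Hcl|].
    intros y Hy. apply HDA, HD. eauto.
  - exact Hx.
  - intros N HN HxN. destruct (Had N HN HxN) as (z & Hz & HzA).
    destruct (Hd z HzA N HN Hz) as (y & Hy & HyD).
    apply HD in HyD as (F & HF & HyF). eauto.
  - destruct HA as [_ HA]. now apply (HA s).
Qed.

(** If [A] is sequentially closed in the union [P] of the closed sets [F] in [C],
    then every [inter A F] is sequentially closed in the whole space, hence
    closed, and the countable family of these sets has union [A]. *)
Lemma sequential_F_sigma_subspaces :
  sequential E X T -> F_sigma_subspaces_sequential E X T.
Proof.
  intros Hseq P TP (C & HC & Hcl & HP) HTP.
  assert (HPX : subset E P X).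
  { intros x Hx. apply HP in Hx as (F & HF & Hx). now apply (proj1 (Hcl F HF)). }
  intros A. split; [|apply closed_seq_closed]. intros [HA Hs].
  assert (Hrel : forall s x, sequence_in E s A -> x ∈ P -> converges E T s x -> x ∈ A).
  { intros s x HsA Hx Hc. apply (Hs s x HsA Hx).
    intros U' HU' HxU'. apply HTP in HU' as (U & HU & HU'). apply HU' in HxU' as [HxU _].
    destruct (Hc U HU HxU) as (m & Hm & H). exists m. split; [exact Hm|].
    intros n y Hn Hmn Hy. apply HU'. split; [eauto|].
    destruct HsA as (w & _ & _ & HsA). apply HA. eauto. }
  assert (HAF : forall F, F ∈ C -> adherent_closed X T (inter A F)).
  { intros F HF. apply (proj1 sequential_iff Hseq). split.
    - intros x Hx. apply in_inter in Hx. apply HPX, HA. tauto.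
    - intros s x (w & Hw & Hsf & HsA) Hx Hc.
      assert (HxF : x ∈ F).
      { apply (proj2 (closed_seq_closed X T F (Hcl F HF)) s); auto.
        exists w. split; [exact Hw|]. split; [exact Hsf|].
        intros n y Hy. apply HsA, in_inter in Hy. tauto. }
      apply in_inter. split; [|exact HxF]. apply (Hrel s); [| |exact Hc].
      + exists w. split; [exact Hw|]. split; [exact Hsf|].
        intros n y Hy. apply HsA, in_inter in Hy. tauto.
      + apply HP. eauto. }
  assert (Had : forall x, x ∈ P -> adherent T A x -> x ∈ A).
  { intros x Hx Had. destruct (Loeb_choice HL) as [f Hf].
    apply countable_iff in HC as [i Hi].
    destruct (well_ordered_closed_sequence f C A x (index_lt i) (inter A) Hf
      (index_lt_well_order i C Hi) (index_lt_definable i)) as (s & HsA & Hc).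
    - dfn.
    - intros F HF. split; [auto|]. intros y Hy. now apply in_inter in Hy.
    - auto.
    - intros N HN HxN. destruct (Had N HN HxN) as (z & Hz & HzA).
      destruct (proj1 (HP z) (HA z HzA)) as (F & HF & HzF).
      exists F, z. rewrite in_inter. auto.
    - now apply (Hrel s). }
  split; [exact HA|].
  destruct (proj2 (closed_iff (closure X T A)) (closure_closed A))
    as (_ & U & HU & HD).
  exists (inter U P). split.
  - apply HTP. exists U. split; [exact HU|]. intros x. apply in_inter.
  - intros x. rewrite in_inter, (HD x), in_closure. split.
    + intros [[Hx Hn] HxP]. split; [exact HxP|]. intros HxA. apply Hn.
      split; [exact Hx | now apply member_adherent].
    + intros [HxP Hn]. split; [|exact HxP]. split; [auto|].
      intros [_ H]. auto.
Qed.

(** The whole space is one of its F-sigma subspaces. *)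
Lemma F_sigma_subspaces_sequential_whole :
  F_sigma_subspaces_sequential E X T -> sequential E X T.
Proof.
  intros H. apply (H X); [apply singleton_F_sigma, whole_closed|].
  intros W. split.
  - intros HW. exists W. split; [exact HW|]. intros x. split.
    + intros Hx. split; [exact Hx | now apply (open_subset W)].
    + tauto.
  - intros (U & HU & HW). replace W with U; [exact HU|]. apply set_ext. intros x.
    rewrite (HW x). split; [|tauto]. intros Hx. split; [exact Hx|].
    now apply (open_subset U).
Qed.

Lemma conditions_equivalent :
  all_equivalent (sequentiality_conditions E X T).
Proof.
  assert (H : forall P, List.In P (sequentiality_conditions E X T) ->
    (P <-> sequential E X T)).
  { pose proof sequential_separable. pose proof separable_wo_dense.
    pose proof wo_dense_sequential. pose proof sequential_choice.
    pose proof choice_sequential. pose proof sequential_F_sigma.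
    pose proof F_sigma_F_sigma_dense. pose proof F_sigma_dense_sequential.
    pose proof sequential_F_sigma_subspaces.
    pose proof F_sigma_subspaces_sequential_whole.
    intros P [<-|[<-|[<-|[<-|[<-|[<-|[<-|[]]]]]]]]; tauto. }
  intros P Q HP HQ. rewrite (H P HP), (H Q HQ). tauto.
Qed.

End Equivalence.
End Space.
(** * Real numbers *)

Lemma binop_iff o x y z : binop E o x y z <-> value E o (opair x y) z.
Proof.
  unfold binop. split.
  - intros (p & Hp & H). apply is_opair_iff in Hp. now subst.
  - intros H. exists (opair x y). now rewrite is_opair_iff.
Qed.

(** The value at [(x, y)] of a function of two variables. *)
Definition op (o x y : V) : V := app o (opair x y).

Section BinaryOperation.

Context (o P a b R : V) (HP : is_product E P a b) (Ho : maps_to E o P R).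

Lemma op_spec x y : x ∈ a -> y ∈ b -> binop E o x y (op o x y).
Proof.
  intros Hx Hy. apply binop_iff. apply (app_spec o P); [apply Ho|].
  apply is_product_iff in HP. subst. now apply opair_in_prod.
Qed.

Lemma op_in x y : x ∈ a -> y ∈ b -> op o x y ∈ R.
Proof.
  intros Hx Hy. apply (app_in o P); [exact Ho|].
  apply is_product_iff in HP. subst. now apply opair_in_prod.
Qed.

Lemma binop_eq x y z : binop E o x y z -> z = op o x y.
Proof.
  intros H. apply (app_eq o P); [apply Ho|]. now apply binop_iff.
Qed.

Lemma binop_domain x y z : binop E o x y z -> x ∈ a /\ y ∈ b.
Proof.
  intros H. apply binop_iff, (function_domain o P) in H; [|apply Ho].
  apply is_product_iff in HP. subst. now apply opair_in_prod.
Qed.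

End BinaryOperation.

Section Reals.

Context (K : field_data V) (HK : is_reals E K).
Local Notation R := (r_carrier K).
Local Notation "x + y" := (op (r_add K) x y).
Local Notation "x * y" := (op (r_mul K) x y).
Local Notation O := (r_zero K).
Local Notation I := (r_one K).
Local Notation "x ≤ y" := (rle E K x y) (at level 70).

Lemma add_spec x y : x ∈ R -> y ∈ R -> binop E (r_add K) x y (x + y).
Proof.
  destruct (reals_add_op E K HK) as (P & HP & Ho). now apply (op_spec _ P R R R).
Qed.

Lemma mul_spec x y : x ∈ R -> y ∈ R -> binop E (r_mul K) x y (x * y).
Proof.
  destruct (reals_mul_op E K HK) as (P & HP & Ho). now apply (op_spec _ P R R R).
Qed.

Lemma add_eq x y z : binop E (r_add K) x y z -> z = x + y.
Proof.
  destruct (reals_add_op E K HK) as (P & HP & Ho). now apply (binop_eq _ P R).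
Qed.

Lemma mul_eq x y z : binop E (r_mul K) x y z -> z = x * y.
Proof.
  destruct (reals_mul_op E K HK) as (P & HP & Ho). now apply (binop_eq _ P R).
Qed.

Lemma add_in x y : x ∈ R -> y ∈ R -> x + y ∈ R.
Proof.
  destruct (reals_add_op E K HK) as (P & HP & Ho). now apply (op_in _ P R R R).
Qed.

Lemma mul_in x y : x ∈ R -> y ∈ R -> x * y ∈ R.
Proof.
  destruct (reals_mul_op E K HK) as (P & HP & Ho). now apply (op_in _ P R R R).
Qed.

Lemma zero_in : O ∈ R. Proof. apply (reals_zero_in E K HK). Qed.
Lemma one_in : I ∈ R. Proof. apply (reals_one_in E K HK). Qed.

Hint Resolve add_in mul_in zero_in one_in add_spec mul_spec : reals.
Local Ltac re := eauto 6 with reals.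

Lemma add_assoc x y z : x ∈ R -> y ∈ R -> z ∈ R -> x + (y + z) = (x + y) + z.
Proof.
  intros Hx Hy Hz. symmetry. apply add_eq.
  apply (reals_add_assoc E K HK x y z (x + y) (y + z)); re.
Qed.

Lemma add_comm x y : x ∈ R -> y ∈ R -> x + y = y + x.
Proof. intros Hx Hy. apply add_eq. apply (reals_add_comm E K HK); re. Qed.

Lemma add_zero x : x ∈ R -> x + O = x.
Proof. intros Hx. symmetry. apply add_eq. now apply (reals_add_zero E K HK). Qed.

Lemma add_opp x : x ∈ R -> exists y, y ∈ R /\ x + y = O.
Proof.
  intros Hx. destruct (reals_add_opp E K HK x Hx) as (y & Hy & H).
  exists y. split; [exact Hy|]. symmetry. now apply add_eq.
Qed.

Lemma mul_comm x y : x ∈ R -> y ∈ R -> x * y = y * x.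
Proof. intros Hx Hy. apply mul_eq. apply (reals_mul_comm E K HK); re. Qed.

Lemma mul_one x : x ∈ R -> x * I = x.
Proof. intros Hx. symmetry. apply mul_eq. now apply (reals_mul_one E K HK). Qed.

Lemma distr x y z : x ∈ R -> y ∈ R -> z ∈ R -> x * (y + z) = x * y + x * z.
Proof.
  intros Hx Hy Hz. apply add_eq.
  apply (reals_distr E K HK x y z (y + z)); re.
Qed.

Lemma le_refl x : x ∈ R -> x ≤ x.
Proof. apply (reals_le_refl E K HK). Qed.

Lemma le_trans x y z : x ∈ R -> y ∈ R -> z ∈ R -> x ≤ y -> y ≤ z -> x ≤ z.
Proof. apply (reals_le_trans E K HK). Qed.

Lemma le_antisym x y : x ∈ R -> y ∈ R -> x ≤ y -> y ≤ x -> x = y.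
Proof. apply (reals_le_antisym E K HK). Qed.

Lemma le_add_r x y z : x ∈ R -> y ∈ R -> z ∈ R -> x ≤ y -> x + z ≤ y + z.
Proof. intros Hx Hy Hz H. apply (reals_le_add E K HK x y z); re. Qed.

Lemma le_add x y z t : x ∈ R -> y ∈ R -> z ∈ R -> t ∈ R ->
  x ≤ y -> z ≤ t -> x + z ≤ y + t.
Proof.
  intros Hx Hy Hz Ht H1 H2. apply (le_trans _ (y + z)); re.
  - now apply le_add_r.
  - rewrite !(add_comm y) by re. now apply le_add_r.
Qed.

Lemma add_sub x y : x ∈ R -> y ∈ R -> exists z, z ∈ R /\ y + z = x.
Proof.
  intros Hx Hy. destruct (add_opp y Hy) as (n & Hn & H).
  exists (n + x). split; [re|]. rewrite add_assoc, H, add_comm, add_zero by re.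
  reflexivity.
Qed.

Lemma le_add_cancel x y z : x ∈ R -> y ∈ R -> z ∈ R -> x + z ≤ y + z -> x ≤ y.
Proof.
  intros Hx Hy Hz H. destruct (add_opp z Hz) as (n & Hn & Hzn).
  apply (le_add_r _ _ n) in H; re.
  rewrite <- !add_assoc, Hzn, !add_zero in H by re. exact H.
Qed.

Lemma add_cancel x y z : x ∈ R -> y ∈ R -> z ∈ R -> x + z = y + z -> x = y.
Proof.
  intros Hx Hy Hz H. apply le_antisym; auto; apply (le_add_cancel _ _ z); auto;
    rewrite H; apply le_refl; re.
Qed.

Lemma lt_iff x y : x ∈ R -> y ∈ R -> (rlt E K x y <-> ~ y ≤ x).
Proof.
  intros Hx Hy. split.
  - intros [H1 Hne] H2. apply Hne. now apply le_antisym.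
  - intros H. destruct (reals_le_total E K HK x y Hx Hy) as [H'|H']; [|tauto].
    split; [exact H'|]. intros <-. auto.
Qed.

Lemma not_lt x y : x ∈ R -> y ∈ R -> ~ rlt E K x y -> y ≤ x.
Proof. intros Hx Hy. rewrite lt_iff by assumption. apply NNPP. Qed.

Lemma lt_le_trans x y z : x ∈ R -> y ∈ R -> z ∈ R ->
  rlt E K x y -> y ≤ z -> rlt E K x z.
Proof.
  intros Hx Hy Hz. rewrite !lt_iff by assumption.
  intros H1 H2 H3. apply H1. now apply (le_trans _ z).
Qed.

Lemma le_lt_trans x y z : x ∈ R -> y ∈ R -> z ∈ R ->
  x ≤ y -> rlt E K y z -> rlt E K x z.
Proof.
  intros Hx Hy Hz. rewrite !lt_iff by assumption.
  intros H1 H2 H3. apply H2. now apply (le_trans _ x).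
Qed.

Lemma lt_add x y z t : x ∈ R -> y ∈ R -> z ∈ R -> t ∈ R ->
  rlt E K x y -> z ≤ t -> rlt E K (x + z) (y + t).
Proof.
  intros Hx Hy Hz Ht H1 H2. apply (lt_le_trans _ (y + z)); re.
  - apply lt_iff; re. intros H. apply le_add_cancel in H; re.
    revert H. now apply lt_iff.
  - apply le_add; re. now apply le_refl.
Qed.

Lemma mul_zero x : x ∈ R -> x * O = O.
Proof.
  intros Hx. apply (add_cancel _ _ (x * O)); re.
  rewrite <- distr, (add_comm O (x * O)), !add_zero by re. reflexivity.
Qed.

Lemma zero_lt_one : rlt E K O I.
Proof.
  apply lt_iff; re. intros H.
  destruct (add_opp I one_in) as (y & Hy & Hiy).
  (* [y = - 1] is non-negative, hence so is [y * y = 1] *)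
  assert (H0 : O ≤ y).
  { apply (le_add_r _ _ y) in H; re.
    rewrite Hiy, (add_comm O), add_zero in H by re. exact H. }
  assert (Hyy : y * y = I).
  { apply (add_cancel _ _ y); re. rewrite Hiy.
    rewrite <- (mul_zero y) by re. rewrite <- Hiy at 1.
    rewrite distr, mul_one by re. apply add_comm; re. }
  apply (reals_one_neq_zero E K HK). apply le_antisym; re.
  rewrite <- Hyy. apply (reals_le_mul E K HK y y); re.
Qed.

(** The field structure serves only to divide by two. *)
Lemma half x : x ∈ R -> rlt E K O x ->
  exists h, h ∈ R /\ rlt E K O h /\ h + h = x.
Proof.
  intros Hx H.
  assert (H2 : I + I <> O).
  { intros He. pose proof zero_lt_one as H1.
    apply (lt_add _ _ O I) in H1; re; [|apply zero_lt_one].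
    rewrite add_zero, He in H1 by re. now apply H1. }
  destruct (reals_mul_inv E K HK (I + I)) as (c & Hc & Hm); [re | exact H2 |].
  apply mul_eq in Hm.
  exists (x * c). assert (Hh : x * c + x * c = x).
  { rewrite <- distr by re. transitivity (x * I); [|now apply mul_one].
    f_equal. rewrite Hm, mul_comm, distr, mul_one by re. reflexivity. }
  split; [re|]. split; [|exact Hh].
  apply lt_iff; re. intros Hn. revert H. rewrite lt_iff by re. intros H. apply H.
  rewrite <- Hh, <- (add_zero O) by re. apply le_add; re.
Qed.

(** * Metric spaces *)

Section Metric.

Context (X d T : V) (Hd : is_metric E K X d) (HT : metric_topology E K X d T).
Local Notation dst x y := (op d x y).

Lemma dist_spec x y : x ∈ X -> y ∈ X -> dist E d x y (dst x y).
Proof.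
  destruct Hd as ((P & HP & Ho) & _). now apply (op_spec _ P X X R).
Qed.

Lemma dist_eq x y r : dist E d x y r -> r = dst x y.
Proof. destruct Hd as ((P & HP & Ho) & _). now apply (binop_eq _ P R). Qed.

Lemma dist_domain x y r : dist E d x y r -> x ∈ X /\ y ∈ X.
Proof. destruct Hd as ((P & HP & Ho) & _). now apply (binop_domain _ P X X R). Qed.

Lemma dist_in x y : x ∈ X -> y ∈ X -> dst x y ∈ R.
Proof. destruct Hd as ((P & HP & Ho) & _). now apply (op_in _ P X X R). Qed.

Hint Resolve dist_spec dist_in : reals.

Lemma dist_nonneg x y : x ∈ X -> y ∈ X -> O ≤ dst x y.
Proof. intros Hx Hy. destruct Hd as (_ & H & _). apply (H x y). re. Qed.

Lemma dist_self x : x ∈ X -> dst x x = O.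
Proof.
  intros Hx. symmetry. apply dist_eq. destruct Hd as (_ & _ & H & _). now apply H.
Qed.

Lemma dist_zero x y : x ∈ X -> y ∈ X -> dst x y = O -> x = y.
Proof.
  intros Hx Hy H. destruct Hd as (_ & _ & H' & _). apply H'; auto.
  rewrite <- H. re.
Qed.

Lemma dist_sym x y : x ∈ X -> y ∈ X -> dst x y = dst y x.
Proof.
  intros Hx Hy. apply dist_eq. destruct Hd as (_ & _ & _ & H & _). apply H. re.
Qed.

Lemma dist_tri x y z : x ∈ X -> y ∈ X -> z ∈ X -> dst x z ≤ dst x y + dst y z.
Proof.
  intros Hx Hy Hz. destruct Hd as (_ & _ & _ & _ & H).
  apply (H x y z (dst x y) (dst y z)); re.
Qed.

(** The open ball. *)
Definition ball (x r : V) : V := sep X (fun y => rlt E K (dst x y) r).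

Lemma in_ball x r y : y ∈ ball x r <-> y ∈ X /\ rlt E K (dst x y) r.
Proof. unfold ball. apply (in_sep X (fun y => rlt E K (op d x y) r)). dfn. Qed.

Lemma ball_center x r : x ∈ X -> rlt E K O r -> x ∈ ball x r.
Proof. intros Hx Hr. apply in_ball. now rewrite dist_self. Qed.

Lemma ball_open x r : x ∈ X -> r ∈ R -> ball x r ∈ T.
Proof.
  intros Hx Hr. apply HT. split.
  - intros y Hy. now apply in_ball in Hy.
  - intros y Hy. apply in_ball in Hy as [Hy Hyr].
    destruct (add_sub r (dst x y)) as (e & He & Hs); [re..|].
    exists e. split; [exact He|]. split.
    + apply lt_iff; re. intros H. revert Hyr. rewrite lt_iff by re.
      intros Hyr. apply Hyr. rewrite <- Hs. rewrite <- (add_zero (dst x y)) at 2 by re.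
      apply le_add; re. apply le_refl. re.
    + intros z t Ht Hte. pose proof (dist_domain _ _ _ Ht) as [_ Hz].
      apply dist_eq in Ht. subst t. apply in_ball. split; [exact Hz|].
      apply (le_lt_trans _ (dst x y + dst y z)); re.
      * now apply dist_tri.
      * rewrite <- Hs. rewrite !(add_comm (dst x y)) by re.
        apply lt_add; re. apply le_refl. re.
Qed.

Lemma open_ball U x : U ∈ T -> x ∈ U ->
  exists r, r ∈ R /\ rlt E K O r /\ subset E (ball x r) U.
Proof.
  intros HU Hx. apply HT in HU as [HUX HU]. destruct (HU x Hx) as (r & Hr & H0 & H).
  exists r. split; [exact Hr|]. split; [exact H0|].
  intros y Hy. apply in_ball in Hy as [Hy Hyr]. apply (H y (dst x y)); re.
Qed.

Lemma metric_regular U x : U ∈ T -> x ∈ U -> exists W, W ∈ T /\ x ∈ W /\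
  forall y, y ∈ X -> adherent T W y -> y ∈ U.
Proof.
  intros HU Hx. assert (HxX : x ∈ X) by (apply HT in HU; now apply HU).
  destruct (open_ball U x HU Hx) as (r & Hr & H0 & H).
  destruct (half r Hr H0) as (h & Hh & Hh0 & Hhr).
  exists (ball x h). split; [now apply ball_open|]. split; [now apply ball_center|].
  intros y Hy Had. destruct (Had (ball y h)) as (z & Hz1 & Hz2).
  - now apply ball_open.
  - now apply ball_center.
  - apply in_ball in Hz1 as [Hz Hz1], Hz2 as [_ Hz2]. apply H, in_ball.
    split; [exact Hy|]. apply (le_lt_trans _ (dst x z + dst z y)); re.
    + now apply dist_tri.
    + rewrite <- Hhr. rewrite (dist_sym z y) by assumption.
      apply lt_add; re. apply Hz1.
Qed.

Lemma small_neighbourhood x u : x ∈ X -> u ∈ R -> rlt E K O u ->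
  exists W, W ∈ T /\ x ∈ W /\ forall p q, p ∈ W -> q ∈ W -> dst p q ≤ u.
Proof.
  intros Hx Hu H0. destruct (half u Hu H0) as (h & Hh & Hh0 & <-).
  exists (ball x h). split; [now apply ball_open|]. split; [now apply ball_center|].
  intros p q Hp Hq. apply in_ball in Hp as [Hp [Hxp _]], Hq as [Hq [Hxq _]].
  apply (le_trans _ (dst p x + dst x q)); re.
  - now apply dist_tri.
  - rewrite (dist_sym p x) by assumption. apply le_add; re.
Qed.

(** * Cantor complete metrics *)

Section Cantor.

Context (HTop : is_topology E X T) (Hc : cantor_complete E K X d).
Context (B j : V) (HB : is_base E T B) (Hj : injection E j B omega).

(** [v] is an upper bound of the distances between points of [G]. *)
Definition bounds (G v : V) : Prop :=
  v ∈ R /\ forall a b, a ∈ G -> b ∈ G -> dst a b ≤ v.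

(** The basic open set [W] meets [G], and the diameter of the part of [G] in
    the closure of [W] is at most half of that of [G].  The diameter of [G] can
    be infinite; its upper bounds replace it. *)
Definition halving (G W : V) : Prop :=
  (exists x, x ∈ G /\ x ∈ W) /\
  exists v, bounds (inter G (closure X T W)) v /\
    forall u, bounds G u -> v + v ≤ u.

(** The intersection of [G] with the closure of the first basic open set that
    halves [G]. *)
Definition halve (G : V) : V :=
  inter G (closure X T (least B (index_lt j) (halving G))).

Lemma definable_halving G : definable1 (halving G).
Proof. unfold halving, bounds. dfn. Qed.

Lemma definable_halve : definable_fun halve.
Proof. unfold halve, least, halving, bounds. dfn. Qed.

(** If [G] has two points, a neighbourhood of [x] of diameter at most half of
    their distance will do; if [G] is a singleton, any neighbourhood will. *)
Lemma halving_exists G x : subset E G X -> x ∈ G -> exists W, W ∈ B /\ halving G W.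
Proof.
  intros HG Hx. pose proof (HG x Hx) as HxX.
  destruct (classic (exists a b, a ∈ G /\ b ∈ G /\ a <> b))
    as [(a & b & Ha & Hb & Hab)|Hno].
  - assert (Hab0 : rlt E K O (dst a b)).
    { split; [apply dist_nonneg; auto|]. intros H. apply Hab, dist_zero; auto. }
    destruct (half (dst a b)) as (h & Hh & Hh0 & Hhh); re.
    destruct (small_neighbourhood x h HxX Hh Hh0) as (U & HU & HxU & HsU).
    destruct (regular_base X T B HB metric_regular U x HU HxU)
      as (W & HW & HxW & Hcl).
    exists W. split; [exact HW|]. split; [eauto|]. exists h. split; [split|].
    + exact Hh.
    + intros p q Hp Hq. apply in_inter in Hp as [_ Hp], Hq as [_ Hq].
      apply in_closure in Hp, Hq. apply HsU; now apply Hcl.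
    + intros u [_ Hu]. rewrite Hhh. now apply Hu.
  - destruct (proj2 HB X x (whole_open X T HTop) HxX) as (W & HW & HxW & _).
    exists W. split; [exact HW|]. split; [eauto|]. exists O. split; [split|].
    + re.
    + intros p q Hp Hq. apply in_inter in Hp as [Hp _], Hq as [Hq _].
      assert (p = q) as <- by (apply NNPP; intros H; apply Hno; eauto).
      rewrite dist_self by auto. apply le_refl. re.
    + intros u [_ Hu]. rewrite add_zero, <- (dist_self x HxX) by re. now apply Hu.
Qed.

Lemma halve_spec G : subset E G X -> nonempty E G ->
  halving G (least B (index_lt j) (halving G)).
Proof.
  intros HG [x Hx]. apply (least_spec B (index_lt j) (halving G)).
  - now apply index_lt_well_order.
  - apply definable_halving.
  - now apply (halving_exists G x).
Qed.

Lemma halve_subset G : subset E (halve G) G.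
Proof. intros x Hx. now apply in_inter in Hx. Qed.

Lemma halve_nonempty G : subset E G X -> nonempty E G -> nonempty E (halve G).
Proof.
  intros HG Hne. destruct (halve_spec G HG Hne) as [(x & Hx & HxW) _].
  exists x. apply in_inter. split; [exact Hx|]. apply in_closure.
  split; [auto | now apply member_adherent].
Qed.

Lemma halve_closed G : adherent_closed X T G -> adherent_closed X T (halve G).
Proof. intros H. apply inter_closed; [exact H | now apply closure_closed]. Qed.

(** A halving sequence that starts at [A]. *)
Definition halving_sequence (A g : V) : Prop :=
  function_on E g omega /\ app g zero = A /\
  forall n, n ∈ omega -> app g (succ n) = halve (app g n).

Section HalvingSequence.

Context (A g : V) (HA : adherent_closed X T A) (Hne : nonempty E A).
Context (Hg : halving_sequence A g).

Lemma halving_sequence_closed n : n ∈ omega ->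
  adherent_closed X T (app g n) /\ nonempty E (app g n).
Proof.
  destruct Hg as (_ & H0 & HS). revert n. apply omega_ind.
  - unfold adherent_closed. dfn.
  - now rewrite H0.
  - intros n Hn [H1 H2]. rewrite HS by exact Hn. split.
    + now apply halve_closed.
    + apply halve_nonempty; [apply H1 | exact H2].
Qed.

Lemma halving_sequence_decreasing n : n ∈ omega ->
  forall m, nat_le E m n -> subset E (app g n) (app g m).
Proof.
  destruct Hg as (_ & H0 & HS). revert n.
  apply (omega_ind (fun n => forall m, nat_le E m n -> subset E (app g n) (app g m)));
    [dfn| |].
  - intros m [Hm | ->]; [destruct (zero_spec m Hm) | intros x; auto].
  - intros n Hn IH m [Hm | ->]; [|intros x; auto].
    apply in_succ in Hm. rewrite HS by exact Hn. intros x Hx.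
    apply (IH m Hm). now apply halve_subset in Hx.
Qed.

(** The supremum [s] of the numbers that are below all the bounds of all the
    terms is not positive, since [s + s] is again such a number. *)
Lemma halving_sequence_small eps : eps ∈ R -> rlt E K O eps ->
  exists n v, n ∈ omega /\ bounds (app g n) v /\ rlt E K v eps.
Proof.
  intros He He0. destruct Hg as (_ & H0 & HS).
  pose (low := fun e => forall n v, n ∈ omega -> bounds (app g n) v -> e ≤ v).
  assert (Dlow : definable1 low) by (unfold low, bounds; dfn).
  assert (Hstep : forall n, n ∈ omega -> exists v, bounds (app g (succ n)) v /\
    forall u, bounds (app g n) u -> v + v ≤ u).
  { intros n Hn. destruct (halving_sequence_closed n Hn) as [[H1 _] H2].
    destruct (halve_spec _ H1 H2) as [_ H]. now rewrite HS. }
  apply NNPP. intros Hno.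
  assert (Hlow : low eps).
  { intros n v Hn Hv. apply not_lt; [apply Hv | exact He |].
    intros H. apply Hno. eauto. }
  destruct (reals_complete E K HK (sep R low)) as (s & Hs & Hub & Hlub).
  - intros x Hx. now apply in_sep in Hx.
  - exists eps. now apply in_sep.
  - destruct (Hstep zero zero_omega) as (v & Hv & _). exists v. split; [apply Hv|].
    intros x Hx. apply in_sep in Hx; [|exact Dlow]. destruct Hx as [_ Hx].
    apply (Hx (succ zero)); [apply succ_omega, zero_omega | exact Hv].
  - assert (Hslow : low s).
    { intros n v Hn Hv. apply Hlub; [apply Hv|].
      intros x Hx. apply in_sep in Hx; [|exact Dlow]. now apply (proj2 Hx n). }
    assert (Hss : s + s ≤ s).
    { apply Hub, in_sep; [exact Dlow|]. split; [re|].
      intros n u Hn Hu. destruct (Hstep n Hn) as (v & Hv & Hvu).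
      assert (HvR : v ∈ R) by apply Hv. assert (HuR : u ∈ R) by apply Hu.
      apply (le_trans _ (v + v)); re.
      apply le_add; re; apply (Hslow (succ n)); auto using succ_omega. }
    assert (Hs0 : s ≤ O).
    { apply (le_add_cancel _ _ s); re. now rewrite (add_comm O), add_zero by re. }
    assert (Hes : eps ≤ s) by (apply Hub, in_sep; auto).
    revert He0. rewrite lt_iff by re. intros He0. apply He0.
    now apply (le_trans _ s); re.
Qed.

(** The common point of the terms exists by Cantor completeness, and it is unique
    because the distance of two common points is below every bound. *)
Lemma halving_sequence_point :
  exists x, (forall n, n ∈ omega -> x ∈ app g n) /\
    forall y, (forall n, n ∈ omega -> y ∈ app g n) -> y = x.
Proof.
  assert (Hf : function_on E g omega) by apply Hg.
  destruct (Hc T HT omega g omega_spec Hf) as [x Hx].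
  - intros n G HG. pose proof (function_domain _ _ _ _ Hf HG) as Hn.
    apply (app_eq _ _ _ _ Hf) in HG. subst G.
    rewrite closed_iff by exact HTop. now apply halving_sequence_closed.
  - intros m n G H Hmn HG HH. pose proof (function_domain _ _ _ _ Hf HH) as Hn.
    apply (app_eq _ _ _ _ Hf) in HG, HH. subst G H.
    now apply halving_sequence_decreasing.
  - intros eps He He0. destruct (halving_sequence_small eps He He0)
      as (m & v & Hm & [Hv Hb] & Hve).
    exists m. split; [now apply natural_iff|].
    intros n G Hn Hmn HG. apply natural_iff in Hn.
    apply (app_eq _ _ _ _ Hf) in HG. subst G.
    destruct (halving_sequence_closed n Hn) as [[HGX _] [x0 Hx0]].
    assert (Hle : forall x y r, x ∈ app g n -> y ∈ app g n -> dist E d x y r -> r ≤ v).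
    { intros x y r Hx Hy Hr. apply dist_eq in Hr. subst r.
      apply Hb; now apply (halving_sequence_decreasing n). }
    assert (Dd : definable1 (fun r => exists x y, x ∈ app g n /\ y ∈ app g n /\
      dist E d x y r)) by dfn.
    destruct (reals_complete E K HK
      (sep R (fun r => exists x y, x ∈ app g n /\ y ∈ app g n /\ dist E d x y r)))
      as (s & Hs & Hub & Hlub).
    + intros r Hr. now apply in_sep in Hr.
    + exists (dst x0 x0). apply in_sep; [exact Dd|]. split; [re|].
      exists x0, x0. split; [assumption|]. split; [assumption|]. re.
    + exists v. split; [exact Hv|]. intros r Hr. apply in_sep in Hr; [|exact Dd].
      destruct Hr as (_ & x & y & Hx & Hy & Hr). now apply (Hle x y).
    + exists s. split.
      * split; [exact Hs|]. split.
        -- intros r (x & y & Hx & Hy & Hr). apply Hub, in_sep; [exact Dd|].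
           split; [|eauto]. apply dist_eq in Hr. subst r. re.
        -- intros u Hu H. apply Hlub; [exact Hu|]. intros r Hr.
           apply in_sep in Hr; [|exact Dd]. now apply H.
      * apply (le_lt_trans _ v); re. apply Hlub; [exact Hv|].
        intros r Hr. apply in_sep in Hr; [|exact Dd].
        destruct Hr as (_ & x & y & Hx & Hy & Hr). now apply (Hle x y).
  - assert (Hx' : forall n, n ∈ omega -> x ∈ app g n).
    { intros n Hn. apply (Hx n). now apply (app_spec g omega). }
    exists x. split; [exact Hx'|]. intros y Hy.
    assert (Hin : forall z, (forall n, n ∈ omega -> z ∈ app g n) -> z ∈ X).
    { intros z Hz. destruct (halving_sequence_closed zero zero_omega) as [[H _] _].
      apply H, Hz, zero_omega. }
    assert (HyX := Hin y Hy). assert (HxX := Hin x Hx').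
    apply dist_zero; [assumption..|]. apply NNPP. intros Hne0.
    assert (H0 : rlt E K O (dst y x)).
    { split; [now apply dist_nonneg | auto]. }
    destruct (halving_sequence_small (dst y x)) as (n & v & Hn & [Hv Hb] & Hlt); re.
    revert Hlt. rewrite lt_iff by re. intros Hlt. apply Hlt, Hb; auto.
Qed.

End HalvingSequence.

Lemma halving_sequence_exists A : adherent_closed X T A -> nonempty E A ->
  exists g, halving_sequence A g.
Proof.
  intros HA Hne.
  assert (DF : definable1 (fun G => adherent_closed X T G /\ nonempty E G))
    by (unfold adherent_closed; dfn).
  pose (Y := sep (power X) (fun G => adherent_closed X T G /\ nonempty E G)).
  assert (HY : forall G, G ∈ Y <-> adherent_closed X T G /\ nonempty E G).
  { intros G. unfold Y. rewrite in_sep by exact DF. rewrite in_power.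
    split; [tauto|]. intros H. split; [apply H | exact H]. }
  destruct (recursion halve Y A definable_halve) as (g & Hg & H0 & HS).
  - apply HY. auto.
  - intros G HG. apply HY in HG as [H1 H2]. apply HY. split.
    + now apply halve_closed.
    + apply halve_nonempty; [apply H1 | exact H2].
  - exists g. split; [apply Hg | auto].
Qed.

Lemma halving_sequence_unique A g h : halving_sequence A g -> halving_sequence A h ->
  forall n, n ∈ omega -> app g n = app h n.
Proof.
  intros (_ & Hg0 & HgS) (_ & Hh0 & HhS). apply omega_ind; [dfn | congruence |].
  intros n Hn IH. now rewrite HgS, HhS, IH.
Qed.

Lemma Cantor_complete_Loeb : Loeb E X T.
Proof.
  pose (pt := fun A => the (fun x => exists g, halving_sequence A g /\
    forall n, n ∈ omega -> x ∈ app g n)).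
  pose proof definable_halve as Dh.
  assert (Dpt : definable_fun pt) by (unfold pt, halving_sequence; dfn).
  assert (Hpt : forall A, adherent_closed X T A -> nonempty E A -> pt A ∈ A).
  { intros A HA Hne. destruct (halving_sequence_exists A HA Hne) as [g Hg].
    destruct (halving_sequence_point A g HA Hne Hg) as (x & Hx & Hu).
    assert (pt A = x) as ->.
    { apply the_eq; [eauto|]. intros y (h & Hh & Hy). apply Hu. intros n Hn.
      rewrite (halving_sequence_unique A g h) by assumption. auto. }
    destruct Hg as (_ & H0 & _). rewrite <- H0. apply Hx, zero_omega. }
  assert (DF : definable1 (fun G => adherent_closed X T G /\ nonempty E G))
    by (unfold adherent_closed; dfn).
  pose (F := sep (power X) (fun G => adherent_closed X T G /\ nonempty E G)).
  assert (HF : forall G, G ∈ F <-> adherent_closed X T G /\ nonempty E G).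
  { intros G. unfold F. rewrite in_sep by exact DF. rewrite in_power.
    split; [tauto|]. intros H. split; [apply H | exact H]. }
  exists F. split.
  - intros A. now rewrite HF, closed_iff by exact HTop.
  - destruct (function_exists pt F X Dpt) as (f & Hf & Hv).
    + intros A HA. apply HF in HA as [HA Hne]. apply HA. now apply Hpt.
    + exists f. split; [apply Hf|]. intros A y Hy. apply Hv in Hy as [HA ->].
      apply HF in HA as [HA Hne]. now apply Hpt.
Qed.

End Cantor.
End Metric.
End Reals.

Lemma metrizable_regular X T U x : metrizable E X T -> U ∈ T -> x ∈ U ->
  exists W, W ∈ T /\ x ∈ W /\ forall y, y ∈ X -> adherent T W y -> y ∈ U.
Proof.
  intros (K & d & HK & Hd & HT). exact (metric_regular K HK X d T Hd HT U x).
Qed.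

Lemma equivalence_Loeb X T :
  is_topology E X T -> second_countable E T -> metrizable E X T -> Loeb E X T ->
  all_equivalent (sequentiality_conditions E X T).
Proof.
  intros HT (B & HB & HBc) Hm HL. apply countable_iff in HBc as [j Hj].
  apply (conditions_equivalent X T HT B j HB Hj); [|exact HL].
  intros U x. now apply metrizable_regular.
Qed.

Lemma equivalence_Cantor X T :
  is_topology E X T -> second_countable E T -> cantor_completely_metrizable E X T ->
  all_equivalent (sequentiality_conditions E X T).
Proof.
  intros HT HS (K & d & HK & Hd & HdT & Hc). apply equivalence_Loeb; auto.
  - exists K, d. auto.
  - destruct HS as (B & HB & HBc). apply countable_iff in HBc as [j Hj].
    exact (Cantor_complete_Loeb K HK X d T Hd HdT HT Hc B j HB Hj).
Qed.


End InModel.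

Theorem theorem3p4 (V : Type) (E : V -> V -> Prop) (HZF : ZF E) :
  (forall X T : V,
     is_topology E X T ->
     second_countable E T -> metrizable E X T -> Loeb E X T ->
     all_equivalent (sequentiality_conditions E X T))
  /\
  (forall X T : V,
     is_topology E X T ->
     second_countable E T -> cantor_completely_metrizable E X T ->
     all_equivalent (sequentiality_conditions E X T)).
Proof.
  split; intros X T.
  - apply equivalence_Loeb, HZF.
  - apply equivalence_Cantor, HZF.
Qed.
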